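(* Let $F:\mathbb{P}^N_{\mathbb{C}_p}\to\mathbb{P}^N_{\mathbb{C}_p}$ be a lift of Frobenius on $\mathbb{P}^N_{\mathbb{C}_p}$. Denote by $\mathrm{Per}$ the set of periodic closed points of $F$ in $\mathbb{P}^N_{\mathbb{C}_p}$. Let $V$ be any irreducible subvariety of $\mathbb{P}^N_{\mathbb{C}_p}$ such that $V\cap \mathrm{Per}$ is Zariski dense in $V$. Then $V$ is periodic, i.e. there exists $\ell\ge 1$ such that $F^{\ell}(V)=V$.
   Context: $p$ is a prime and $\mathbb{C}_p$ is the completion of an algebraic closure of $\mathbb{Q}_p$, with valuation ring $\mathbb{C}_p^{\circ}$ and maximal ideal $\mathbb{C}_p^{\circ\circ}$. A lift of Frobenius on $\mathbb{P}^N_{\mathbb{C}_p}$ is an endomorphism of the form $$F:[x_0:\cdots:x_N]\mapsto [x_0^q+p'P_0(x_0,\dots,x_N):\cdots:x_N^q+p'P_N(x_0,\dots,x_N)],$$ where $q=p^s$ with $s\geq 1$, $p'\in\mathbb{C}_p^{\circ\circ}$, and $P_0,\dots,P_N\in\mathbb{C}_p^{\circ}[x_0,\dots,x_N]$ are homogeneous polynomials of degree $q$. A point $x$ is periodic if $F^n(x)=x$ for some $n>0$. Subvarieties are Zariski closed. *)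

(* Defs.v *)
From HB Require Import structures.
From mathcomp Require Import all_boot all_order all_algebra generic_quotient.
From mathcomp Require Import boolp classical_sets reals mpoly.

Set Implicit Arguments.
Unset Strict Implicit.
Unset Printing Implicit Defensive.

Import Order.TTheory GRing.Theory Num.Theory.

Local Open Scope ring_scope.
Local Open Scope classical_set_scope.
Local Open Scope quotient_scope.

Definition padic_abs (R : realType) (p : nat) (x : rat) : R :=
  if x == 0 then 0
  else p%:R ^ ((logn p `|denq x|%N)%:Z - (logn p `|numq x|%N)%:Z).

Record nonarch_abs (R : realType) (K : fieldType) (a : K -> R) : Prop := {
  nonarch_abs_ge0 : forall x, 0 <= a x;
  nonarch_abs_eq0 : forall x, a x = 0 <-> x = 0;
  nonarch_absM : forall x y, a (x * y) = a x * a y;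
  nonarch_absD : forall x y, a (x + y) <= Num.max (a x) (a y)
}.

Definition abs_complete (R : realType) (K : fieldType) (a : K -> R) : Prop :=
  forall u : nat -> K,
    (forall e : R, 0 < e -> exists n0 : nat, forall m n : nat,
      (n0 <= m)%N -> (n0 <= n)%N -> a (u m - u n) < e) ->
    exists l : K, forall e : R, 0 < e -> exists n0 : nat, forall n : nat,
      (n0 <= n)%N -> a (u n - l) < e.

(* [(L, b)], with the embedding [i], is a completion of [(K, a)]. *)
Record is_completion (R : realType) (K L : fieldType) (a : K -> R) (b : L -> R)
    (i : {rmorphism K -> L}) : Prop := {
  completion_abs : nonarch_abs b;
  completion_isometry : forall x, b (i x) = a x;
  completion_dense : forall (y : L) (e : R), 0 < e -> exists x, b (y - i x) < e;
  completion_complete : abs_complete b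
}.

(* C_p is determined by its construction only up to isometric isomorphism (an
   algebraic closure is), so it is specified by the tower
   Q --> Q_p --> Qbar_p --> C_p: completion of Q for the p-adic absolute value,
   algebraic closure with an extension of the absolute value, completion. *)
Definition is_Cp (R : realType) (p : nat) (C : fieldType) (a : C -> R) : Prop :=
  exists (Qp : fieldType) (aQp : Qp -> R) (i : {rmorphism rat -> Qp})
         (Qpbar : closedFieldType) (aQpbar : Qpbar -> R)
         (j : {rmorphism Qp -> Qpbar}) (k : {rmorphism Qpbar -> C}),
    [/\ is_completion (@padic_abs R p) aQp i,
        forall x : Qpbar, algebraicOver j x,
        nonarch_abs aQpbar,
        forall x : Qp, aQpbar (j x) = aQp x &
        is_completion aQpbar a k].

Section ProjectiveSpace.
Variables (C : fieldType) (N : nat).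

Definition nzvec := {v : 'rV[C]_N.+1 | v != 0}.

Definition proportional (u v : nzvec) : bool :=
  `[< exists2 c : C, c != 0 & val v = c *: val u >].

Lemma proportional_refl : reflexive proportional.
Proof. by move=> u; apply/asboolP; exists 1; rewrite ?oner_eq0 ?scale1r. Qed.

Lemma proportional_imp u v : proportional u v -> proportional v u.
Proof.
move=> /asboolP[c c0 e]; apply/asboolP; exists c^-1; first by rewrite invr_eq0.
by rewrite e scalerA mulVf ?scale1r.
Qed.

Lemma proportional_sym : ssrbool.symmetric proportional.
Proof. by move=> u v; apply/idP/idP; exact: proportional_imp. Qed.

Lemma proportional_trans : transitive proportional.
Proof.
move=> v u w /asboolP[c c0 e] /asboolP[d d0 f]; apply/asboolP.
by exists (d * c); rewrite ?mulf_neq0// f e scalerA.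
Qed.

Canonical proportional_equiv :=
  EquivRel proportional proportional_refl proportional_sym proportional_trans.

(* C-rational points of P^N: all its closed points, as C_p is algebraically
   closed. *)
Definition proj_space := {eq_quot proportional_equiv}.

(* [v] is a system of homogeneous coordinates of the point [x]. *)
Definition hcoords (x : proj_space) (v : 'rV[C]_N.+1) : Prop :=
  exists v0 : v != 0, x = \pi_proj_space (exist _ v v0).

Definition vanishes_at (f : {mpoly C[N.+1]}) (x : proj_space) : Prop :=
  forall v, hcoords x v -> f.@[v ord0] = 0.

Definition zariski_closed (Z : set proj_space) : Prop :=
  exists2 S : set {mpoly C[N.+1]},
    (forall f, S f -> exists d : nat, f \is d.-homog) &
    Z = [set x | forall f, S f -> vanishes_at f x].

Definition zariski_closure (A : set proj_space) : set proj_space :=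
  smallest zariski_closed A.

Definition zariski_dense_in (A V : set proj_space) : Prop :=
  A `<=` V /\ V `<=` zariski_closure A.

Definition irreducible_subvariety (V : set proj_space) : Prop :=
  [/\ zariski_closed V, V !=set0 &
      forall Z1 Z2, zariski_closed Z1 -> zariski_closed Z2 ->
        V = Z1 `|` Z2 -> V = Z1 \/ V = Z2].

Definition periodic_points (F : proj_space -> proj_space) : set proj_space :=
  [set x | exists2 n : nat, (0 < n)%N & iter n F x = x].

Definition lift_coords (q : nat) (p' : C) (P : 'I_N.+1 -> {mpoly C[N.+1]})
    (v : 'rV[C]_N.+1) : 'rV[C]_N.+1 :=
  \row_i (v ord0 i ^+ q + p' * (P i).@[v ord0]).

(* [hcoords] includes nonvanishing; that the right-hand side below never
   vanishes, so that such an [F] always exists, is proved after this section. *)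
Definition lift_of_Frobenius (R : realType) (p : nat) (a : C -> R)
    (F : proj_space -> proj_space) : Prop :=
  exists (s : nat) (p' : C) (P : 'I_N.+1 -> {mpoly C[N.+1]}),
    let q := (p ^ s)%N in
    [/\ (1 <= s)%N,
        a p' < 1,
        forall i, P i \is q.-homog,
        forall i m, a (P i)@_m <= 1 &
        forall x v, hcoords x v -> hcoords (F x) (lift_coords q p' P v)].

End ProjectiveSpace.

Section LiftWellDefined.
Variables (R : realType) (C : fieldType) (a : C -> R) (N : nat).
Hypothesis abs_a : nonarch_abs a.

Let a0 : a 0 = 0. Proof. exact/(nonarch_abs_eq0 abs_a). Qed.

Let a_gt0 x : x != 0 -> 0 < a x.
Proof.
move=> x0; rewrite lt_neqAle (nonarch_abs_ge0 abs_a) andbT eq_sym.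
by apply: contra_neq x0 => /(nonarch_abs_eq0 abs_a).
Qed.

Let a1 : a 1 = 1.
Proof.
have h : a 1 != 0 by rewrite gt_eqF// a_gt0// oner_eq0.
by apply: (mulfI h); rewrite -(nonarch_absM abs_a) !mulr1.
Qed.

Let aX x n : a (x ^+ n) = a x ^+ n.
Proof.
by elim: n => [|n IH]; rewrite ?expr0 ?a1// !exprS (nonarch_absM abs_a) IH.
Qed.

Let aN x : a (- x) = a x.
Proof.
have : a (- x) ^+ 2 == a x ^+ 2 by rewrite -!aX sqrrN.
by rewrite eqrXn2 ?(nonarch_abs_ge0 abs_a)// => /eqP.
Qed.

Let meval_le (f : {mpoly C[N.+1]}) (q : nat) (v : 'I_N.+1 -> C) (M : R) :
  f \is q.-homog -> (forall m, a f@_m <= 1) -> (forall i, a (v i) <= M) ->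
  a f.@[v] <= M ^+ q.
Proof.
move=> fq fi vM; have M0 : 0 <= M.
  by exact: le_trans (nonarch_abs_ge0 abs_a _) (vM ord0).
rewrite mevalE big_seq; elim/big_ind: _ => [|x y hx hy|m mf].
- by rewrite a0 exprn_ge0.
- by apply: le_trans (nonarch_absD abs_a _ _) _; rewrite ge_max hx hy.
rewrite (nonarch_absM abs_a) -[leRHS]mul1r.
apply: ler_pM; rewrite ?(nonarch_abs_ge0 abs_a)//.
have -> : q = (\sum_i m i)%N.
  by rewrite -mdegE; apply/esym; exact: (dhomogP _ _ _ fq).
elim/big_rec2: _ => [|i y x _ h]; first by rewrite a1.
rewrite (nonarch_absM abs_a) exprD ler_pM ?(nonarch_abs_ge0 abs_a)// aX.
by rewrite lerXn2r ?nnegrE ?(nonarch_abs_ge0 abs_a).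
Qed.

Lemma lift_coords_neq0 (q : nat) (p' : C) (P : 'I_N.+1 -> {mpoly C[N.+1]})
    (v : 'rV[C]_N.+1) :
  a p' < 1 -> (forall i, P i \is q.-homog) -> (forall i m, a (P i)@_m <= 1) ->
  v != 0 -> lift_coords q p' P v != 0.
Proof.
move=> p'1 Pq Pi v0.
have [i _ imax] :
    exists2 i, true & forall j, true -> a (v ord0 j) <= a (v ord0 i).
  case: (arg_maxP (fun j => a (v ord0 j)) (isT : xpredT (@ord0 N))) => i.
  by exists i.
have vi0 : 0 < a (v ord0 i).
  have /rV0Pn[j vj] := v0.
  by apply: lt_le_trans (imax j isT); exact: a_gt0.
apply/negP => /eqP/rowP/(_ i); rewrite !mxE => /eqP.
rewrite addr_eq0 => /eqP /(congr1 a).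
rewrite aN aX (nonarch_absM abs_a) => e.
have := @meval_le _ q (v ord0) _ (Pq i) (Pi i) (fun j => imax j isT).
move=> /(ler_wpM2l (nonarch_abs_ge0 abs_a p')); rewrite -e leNgt.
by rewrite gtr_pMl ?exprn_gt0// p'1.
Qed.

Lemma lift_coordsZ (q : nat) (p' : C) (P : 'I_N.+1 -> {mpoly C[N.+1]})
    (c : C) (v : 'rV[C]_N.+1) :
  (forall i, P i \is q.-homog) ->
  lift_coords q p' P (c *: v) = c ^+ q *: lift_coords q p' P v.
Proof.
move=> Pq; apply/rowP => i; rewrite !mxE exprMn mulrDr; congr (_ + _).
rewrite mulrCA; congr (_ * _).
rewrite (@meval_eq _ _ _ (fun j => c * v ord0 j)); last first.
  by move=> j; rewrite mxE.
rewrite !mevalE mulr_sumr big_seq [RHS]big_seq; apply: eq_bigr => m mP.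
rewrite mulrCA; congr (_ * _).
have -> : q = (\sum_i m i)%N.
  by rewrite -mdegE; apply/esym; exact: (dhomogP _ _ _ (Pq i)).
by rewrite -prodrXr -big_split; apply: eq_bigr => j _; rewrite /= exprMn.
Qed.

Lemma lift_of_Frobenius_exists (p s : nat) (p' : C)
    (P : 'I_N.+1 -> {mpoly C[N.+1]}) (q := (p ^ s)%N) :
  a p' < 1 -> (forall i, P i \is q.-homog) -> (forall i m, a (P i)@_m <= 1) ->
  exists F : proj_space C N -> proj_space C N,
    forall x v, hcoords x v -> hcoords (F x) (lift_coords q p' P v).
Proof.
move=> p'1 Pq Pi.
exists (fun x => \pi_(proj_space C N) (exist (fun v => v != 0) _
  (lift_coords_neq0 p'1 Pq Pi (valP (repr x))))).
move=> x v [v0 ex]; exists (lift_coords_neq0 p'1 Pq Pi v0).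
apply/eqmodP/asboolP.
have /eqmodP/asboolP[c c0 /= ec] :
    \pi_(proj_space C N) (repr x) = \pi_(proj_space C N) (exist _ v v0).
  by rewrite reprK.
by exists (c ^+ q); rewrite ?expf_neq0//= ec lift_coordsZ.
Qed.

End LiftWellDefined.

(* Main.v *)
(* Per maps injectively to its reduction, on which F acts as x -> x^q. For a
   homogeneous f and e > 0, the set of periodic x with |f(x)| <= e is the set of
   those whose reduction lies in some Zariski closed set: over a discretely
   valued subfield with uniformizer pi, f o F^t = f^Q + pi f1 with Q = q^t, so
   that |f| <= |pi|^(j+1) at x = F^t(z) amounts to |f(x)| < 1 and
   |f1(z)| <= |pi|^j, and one can induct on j. By noetherianity the reduction of
   V and Per is therefore closed in that of Per, cut out by finitely many
   polynomials whose coefficients have reductions in a finite field; it is stable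
   under some power L of the Frobenius map, so F^L preserves the intersection of V
   and Per, hence V by density. Finally F^L(V) = V because F^L is finite: if the
   fiber over y in V misses V, Nakayama's lemma gives a polynomial D with
   D o F^L = 0 on V and D(y) = 1; but D vanishes on the intersection of V and
   Per, which F^L permutes, hence on V. *)
From HB Require Import structures.
Require Import Defs.
From mathcomp Require Import all_boot all_order all_algebra generic_quotient.
From mathcomp Require Import fieldext.
From mathcomp Require Import boolp classical_sets reals mpoly ring zify.

Set Implicit Arguments.
Unset Strict Implicit.
Unset Printing Implicit Defensive.

Import Order.TTheory GRing.Theory Num.Theory.

Local Open Scope ring_scope.
Local Open Scope classical_set_scope.
Local Open Scope quotient_scope.

(** * Small elements and Gauss norms *)

(** Reductions are never formed as points over the residue field: for homogeneous coordinates [v] of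
    maximum norm 1, the reduction of [g] vanishes at that of [v] when [a g.@[v] < 1], and
    polynomials are congruent when their difference has small coefficients. The induction divides by
    a uniformizer, but C_p is not discretely valued, and F and V need not be defined over a
    discretely valued subfield. Approximation is enough: for given f and e only the finitely many
    coefficients of f and F matter, and they are close to elements of a finite extension K of Q_p
    depending on f and e. Hence the rings K° + pi^j C°, where each division by pi costs one unit of
    j. The exponent L must not depend on f and e: it is read off beforehand from the finitely many
    polynomials cutting out the reductions. It exists because the residue field is algebraic over
    F_p, so that a power of Frobenius fixes any finite set of residues. Polynomials are evaluated on
    the affine cone, where a periodic point is periodic only up to a scalar of absolute value 1;
    this is why the conditions are homogeneous. *)

(* Instantiated by (C°, C°°) and by the polynomials with coefficients in them. *)
Record small_ideal (B : comNzRingType) (p : nat) (S I : B -> Prop) : Prop := {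
  sid_prime : prime p;
  sid_1 : S 1;
  sid_B : forall x y, S x -> S y -> S (x - y);
  sid_M : forall x y, S x -> S y -> S (x * y);
  sid_I0 : I 0;
  sid_IB : forall x y, I x -> I y -> I (x - y);
  sid_IM : forall x y, S x -> I y -> I (x * y);
  sid_IS : forall x, I x -> S x;
  sid_p : I p%:R
}.

Section SmallIdeal.
Variables (B : comNzRingType) (p : nat) (S I : B -> Prop).
Hypothesis H : small_ideal p S I.

Lemma sid_S0 : S 0.
Proof. exact/(sid_IS H)/(sid_I0 H). Qed.

Lemma sid_N x : S x -> S (- x).
Proof. by move=> h; rewrite -sub0r; apply: (sid_B H) => //; exact: sid_S0. Qed.

Lemma sid_D x y : S x -> S y -> S (x + y).
Proof. by move=> hx hy; rewrite -[y]opprK; apply: (sid_B H) => //; exact: sid_N. Qed.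

Lemma sid_IN x : I x -> I (- x).
Proof. by move=> h; rewrite -sub0r; apply: (sid_IB H) => //; exact: (sid_I0 H). Qed.

Lemma sid_ID x y : I x -> I y -> I (x + y).
Proof. by move=> hx hy; rewrite -[y]opprK; apply: (sid_IB H) => //; exact: sid_IN. Qed.

Lemma sid_X x n : S x -> S (x ^+ n).
Proof.
move=> h; elim: n => [|n IH]; rewrite ?expr0; first exact: (sid_1 H).
by rewrite exprS; apply: (sid_M H).
Qed.

Lemma sid_sum (T : Type) (r : seq T) (P : pred T) (F : T -> B) :
  (forall i, P i -> S (F i)) -> S (\sum_(i <- r | P i) F i).
Proof.
by move=> h; elim/big_ind: _ => // [|x y]; [exact: sid_S0|exact: sid_D].
Qed.

Lemma sid_Isum (T : Type) (r : seq T) (P : pred T) (F : T -> B) :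
  (forall i, P i -> I (F i)) -> I (\sum_(i <- r | P i) F i).
Proof.
by move=> h; elim/big_ind: _ => // [|x y]; [exact: (sid_I0 H)|exact: sid_ID].
Qed.

Lemma sid_natr n : S n%:R.
Proof.
elim: n => [|n IH]; first exact: sid_S0.
by rewrite -addn1 natrD; apply: sid_D => //; exact: (sid_1 H).
Qed.

Lemma sid_trans x y z : I (x - y) -> I (y - z) -> I (x - z).
Proof. by move=> hx hy; rewrite -(subrKA y); exact: sid_ID. Qed.

Lemma sid_sym x y : I (x - y) -> I (y - x).
Proof. by move=> h; rewrite -opprB; exact: sid_IN. Qed.

Lemma sid_congrM x y x' y' :
  S x -> S y' -> I (x - x') -> I (y - y') -> I (x * y - x' * y').
Proof.
move=> hx hy h h'; apply: (@sid_trans _ (x * y')).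
  by rewrite -mulrBr; apply: (sid_IM H).
by rewrite -mulrBl mulrC; apply: (sid_IM H).
Qed.

Lemma sid_congrS x y : I (x - y) -> S x -> S y.
Proof.
move=> h hx; rewrite -[y](subKr x).
by apply: (sid_B H) => //; exact: (sid_IS H).
Qed.

Lemma sid_congrX x y n : S x -> I (x - y) -> I (x ^+ n - y ^+ n).
Proof.
move=> hx h; have hy := sid_congrS h hx.
elim: n => [|n IH]; first by rewrite !expr0 subrr; exact: (sid_I0 H).
by rewrite !exprS; apply: sid_congrM => //; exact: sid_X.
Qed.

Lemma sid_congr_prod (T : Type) (r : seq T) (F G : T -> B) :
  (forall i, S (F i)) -> (forall i, I (F i - G i)) ->
  I (\prod_(i <- r) F i - \prod_(i <- r) G i).
Proof.
move=> hF h; elim: r => [|i r IH]; first by rewrite !big_nil subrr; exact: (sid_I0 H).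
rewrite !big_cons; apply: sid_congrM => //.
elim/big_ind: _ => [|x y|j _]; [exact: (sid_1 H)|exact: (sid_M H)|].
exact: sid_congrS (h j) (hF j).
Qed.

Lemma sid_congr_sum (T : Type) (r : seq T) (F G : T -> B) :
  (forall i, I (F i - G i)) ->
  I (\sum_(i <- r) F i - \sum_(i <- r) G i).
Proof. by move=> h; rewrite -sumrB; apply: sid_Isum. Qed.

Lemma sid_frobD x y : S x -> S y -> I ((x + y) ^+ p - (x ^+ p + y ^+ p)).
Proof.
move=> hx hy; have p_prime := sid_prime H.
have p_gt0 := prime_gt0 p_prime.
rewrite exprDn -(prednK p_gt0) big_ord_recl big_ord_recr /= prednK //.
rewrite subn0 bin0 mulr1n expr0 mulr1 /bump /= add1n prednK // subnn expr0.
rewrite binn mulr1n mul1r addrCA addrK.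
apply: sid_Isum => i _; have ip : (i.+1 < p)%N by rewrite -ltn_predRL.
have /dvdnP[c ->] : (p %| 'C(p, bump 0 i))%N.
  by apply: prime_dvd_bin => //; rewrite /bump add1n.
rewrite mulrnA -mulr_natr; apply: (sid_IM H); last exact: (sid_p H).
rewrite -mulr_natr; apply: (sid_M H); last exact: sid_natr.
by apply: (sid_M H); exact: sid_X.
Qed.

Lemma sid_frobD_exp k x y :
  S x -> S y -> I ((x + y) ^+ (p ^ k) - (x ^+ (p ^ k) + y ^+ (p ^ k))).
Proof.
move=> hx hy; elim: k => [|k IH].
  by rewrite !expr1 subrr; exact: (sid_I0 H).
rewrite expnSr !exprM; apply: sid_trans (sid_frobD (sid_X _ hx) (sid_X _ hy)).
by apply: sid_congrX IH; apply: sid_X; exact: sid_D.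
Qed.

Lemma sid_frob_sum k (T : Type) (r : seq T) (F : T -> B) :
  (forall i, S (F i)) ->
  I ((\sum_(i <- r) F i) ^+ (p ^ k) - \sum_(i <- r) F i ^+ (p ^ k)).
Proof.
move=> hF; elim: r => [|i r IH].
  rewrite !big_nil expr0n expn_eq0 eqn0Ngt prime_gt0 ?(sid_prime H) //= subrr.
  exact: (sid_I0 H).
rewrite !big_cons; apply: sid_trans (sid_frobD_exp _ _ _) _ => //.
  exact: sid_sum.
by rewrite opprD addrACA subrr add0r.
Qed.

End SmallIdeal.

Section Abs.
Variables (R : realType) (C : fieldType) (a : C -> R).
Hypothesis aP : nonarch_abs a.

Lemma abs_ge0 x : 0 <= a x.
Proof. exact: (nonarch_abs_ge0 aP). Qed.
Hint Resolve abs_ge0 : core.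

Lemma absM x y : a (x * y) = a x * a y.
Proof. exact: (nonarch_absM aP). Qed.

Lemma abs0 : a 0 = 0. Proof. exact/(nonarch_abs_eq0 aP). Qed.

Lemma abs_eq0 x : (a x == 0) = (x == 0).
Proof. by apply/eqP/eqP => [/(nonarch_abs_eq0 aP)//|->]; exact: abs0. Qed.

Lemma abs_gt0 x : (0 < a x) = (x != 0).
Proof. by rewrite lt_neqAle abs_ge0 andbT eq_sym abs_eq0. Qed.

Lemma abs1 : a 1 = 1.
Proof.
have h : a 1 != 0 by rewrite abs_eq0 oner_eq0.
by apply: (mulfI h); rewrite -absM !mulr1.
Qed.

Lemma absX x n : a (x ^+ n) = a x ^+ n.
Proof. by elim: n => [|n IH]; rewrite ?expr0 ?abs1// !exprS absM IH. Qed.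

Lemma absN x : a (- x) = a x.
Proof.
have : a (- x) ^+ 2 == a x ^+ 2 by rewrite -!absX sqrrN.
by rewrite eqrXn2 ?abs_ge0// => /eqP.
Qed.

Lemma abs_distC x y : a (x - y) = a (y - x).
Proof. by rewrite -absN opprB. Qed.

Lemma absV x : a x^-1 = (a x)^-1.
Proof.
have [->|x0] := eqVneq x 0; first by rewrite invr0 abs0 invr0.
have ax0 : a x != 0 by rewrite abs_eq0.
by apply: (mulfI ax0); rewrite -absM !divff// abs1.
Qed.

Lemma abs_prod (T : Type) (r : seq T) (F : T -> C) :
  a (\prod_(i <- r) F i) = \prod_(i <- r) a (F i).
Proof. by elim/big_rec2: _ => [|i y x _ <-]; rewrite ?abs1 ?absM. Qed.

Lemma absD_le x y r : a x <= r -> a y <= r -> a (x + y) <= r.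
Proof.
by move=> hx hy; apply: le_trans (nonarch_absD aP _ _) _; rewrite ge_max hx hy.
Qed.

Lemma absB_le x y r : a x <= r -> a y <= r -> a (x - y) <= r.
Proof. by move=> hx hy; apply: absD_le; rewrite ?absN. Qed.

Lemma absD_lt x y r : a x < r -> a y < r -> a (x + y) < r.
Proof.
by move=> hx hy; apply: le_lt_trans (nonarch_absD aP _ _) _; rewrite gt_max hx hy.
Qed.

Lemma absB_lt x y r : a x < r -> a y < r -> a (x - y) < r.
Proof. by move=> hx hy; apply: absD_lt; rewrite ?absN. Qed.

Lemma abs_sum_le (T : Type) (s : seq T) (P : pred T) (F : T -> C) r :
  0 <= r -> (forall i, P i -> a (F i) <= r) -> a (\sum_(i <- s | P i) F i) <= r.
Proof.
by move=> r0 h; elim/big_ind: _ => // [|x y]; rewrite ?abs0//; exact: absD_le.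
Qed.

Lemma abs_sum_lt (T : Type) (s : seq T) (P : pred T) (F : T -> C) r :
  0 < r -> (forall i, P i -> a (F i) < r) -> a (\sum_(i <- s | P i) F i) < r.
Proof.
by move=> r0 h; elim/big_ind: _ => // [|x y]; rewrite ?abs0//; exact: absD_lt.
Qed.

Lemma abs_eq_lt x y : a (x - y) < a x -> a y = a x.
Proof.
move=> h; apply/eqP; rewrite eq_le; apply/andP; split.
  by rewrite -[y](subKr x); apply: absB_le => //; exact: ltW.
rewrite leNgt; apply/negP => h'.
by have := absD_lt h h'; rewrite subrK ltxx.
Qed.

Lemma abs_natr_le1 n : a n%:R <= 1.
Proof.
elim: n => [|n IH]; first by rewrite abs0.
by rewrite -addn1 natrD; apply: absD_le; rewrite ?abs1.
Qed.

Lemma abs_small_ideal p : prime p -> a p%:R < 1 ->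
  small_ideal p (fun x => a x <= 1) (fun x => a x < 1).
Proof.
move=> pp ap; split=> //.
- by rewrite abs1.
- by move=> x y; exact: absB_le.
- by move=> x y; rewrite absM; exact: mulr_ile1.
- by rewrite abs0.
- by move=> x y; exact: absB_lt.
- move=> x y hx hy; rewrite absM; apply: le_lt_trans hy.
  exact: ler_piMl.
- by move=> x /ltW.
Qed.

Section Gauss.
Variable n : nat.
Implicit Types f g : {mpoly C[n]}.

Definition coef_le f r := forall m, a f@_m <= r.
Definition coef_lt1 f := forall m, a f@_m < 1.

Lemma coef_le0 r : 0 <= r -> coef_le 0 r.
Proof. by move=> r0 m; rewrite mcoeff0 abs0. Qed.

Lemma coef_leB f g r : coef_le f r -> coef_le g r -> coef_le (f - g) r.
Proof. by move=> hf hg m; rewrite mcoeffB; exact: absB_le. Qed.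

Lemma coef_leM f g r s :
  0 <= r -> 0 <= s -> coef_le f r -> coef_le g s -> coef_le (f * g) (r * s).
Proof.
move=> r0 s0 hf hg m; rewrite mcoeffM; apply: abs_sum_le => [|i _].
  exact: mulr_ge0.
by rewrite absM ler_pM.
Qed.

Lemma coef_leZ c f r : coef_le f r -> coef_le (c *: f) (a c * r).
Proof. by move=> h m; rewrite mcoeffZ absM ler_wpM2l. Qed.

Lemma coef_lt1_le f : coef_lt1 f -> coef_le f 1.
Proof. by move=> h m; exact: ltW. Qed.

(** There are finitely many coefficients, so they stay away from 1, and strict bounds reduce to
    non-strict ones. *)
Lemma coef_lt1_bound f : coef_lt1 f -> exists2 r, 0 <= r < 1 & coef_le f r.
Proof.
move=> h; exists (\big[Num.max/0]_(m <- msupp f) a f@_m).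
  apply/andP; split.
    by elim/big_ind: _ => // x y; rewrite le_max => ->.
  by elim/big_ind: _ => // x y; rewrite gt_max => -> ->.
move=> m; have [fm|fm] := boolP (m \in msupp f).
  elim: (msupp f) fm => // k s IH; rewrite inE big_cons le_max.
  by move=> /orP[/eqP<-|/IH->]; rewrite ?lexx ?orbT.
rewrite (memN_msupp_eq0 fm) abs0.
by elim/big_ind: _ => // x y; rewrite le_max => ->.
Qed.

Lemma coef_le_X m : coef_le 'X_[m] 1.
Proof.
by move=> k; rewrite mcoeffX; case: eqP => _; rewrite ?abs1 ?abs0.
Qed.

Lemma coef_le_C c r : 0 <= r -> a c <= r -> coef_le c%:MP r.
Proof.
by move=> r0 h m; rewrite mcoeffC; case: eqP => _; rewrite ?mulr1 // mulr0 abs0.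
Qed.

Lemma gauss_small_ideal p : prime p -> a p%:R < 1 ->
  small_ideal p (fun f => coef_le f 1) coef_lt1.
Proof.
move=> pp ap; split=> //.
- by rewrite -mpolyX0; exact: coef_le_X.
- by move=> x y; exact: coef_leB.
- by move=> x y hx hy; rewrite -[1]mulr1; apply: coef_leM.
- by move=> m; rewrite mcoeff0 abs0.
- by move=> x y hx hy m; rewrite mcoeffB; exact: absB_lt.
- move=> x y hx /coef_lt1_bound[r /andP[r0 r1] hr] m.
  by apply: le_lt_trans r1; rewrite -[r]mul1r; apply: coef_leM.
- exact: coef_lt1_le.
- move=> m; rewrite -mpolyC_nat mcoeffC; case: eqP => _; first by rewrite mulr1.
  by rewrite mulr0 abs0.
Qed.

Lemma meval_le f r (v : 'I_n -> C) :
  0 <= r -> coef_le f r -> (forall i, a (v i) <= 1) -> a f.@[v] <= r.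
Proof.
move=> r0 h hv; rewrite mevalE; apply: abs_sum_le => // m _.
rewrite absM -[r]mulr1; apply: ler_pM => //; rewrite abs_prod.
suff /andP[] : 0 <= \prod_(i < n) a (v i ^+ m i) <= 1 by [].
elim/big_ind: _ => [|x y /andP[x0 x1] /andP[y0 y1]|i _].
- by rewrite ler01 lexx.
- by rewrite mulr_ge0 ?mulr_ile1.
- by rewrite absX exprn_ge0 ?exprn_ile1.
Qed.

Lemma meval_lt1 f (v : 'I_n -> C) :
  coef_lt1 f -> (forall i, a (v i) <= 1) -> a f.@[v] < 1.
Proof.
move=> /coef_lt1_bound[r /andP[r0 r1] hr] hv.
by apply: le_lt_trans r1; exact: meval_le.
Qed.

Lemma coef_le_scale f : exists2 c, c != 0 & coef_le (c *: f) 1.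
Proof.
have [->|f0] := eqVneq f 0.
  by exists 1; rewrite ?oner_eq0// scaler0; exact: coef_le0.
have [m ms mx] : exists2 m, m \in msupp f & forall k, k \in msupp f -> a f@_k <= a f@_m.
  have : msupp f != [::] by rewrite msupp_eq0.
  elim: (msupp f) => // k s IH _; have [->|/IH[m ms h]] := eqVneq s [::].
    by exists k; rewrite ?inE// => l; rewrite inE => /eqP->.
  have [h'|/ltW h'] := leP (a f@_k) (a f@_m).
    by exists m; rewrite ?inE ?ms ?orbT// => l; rewrite inE => /orP[/eqP->//|/h].
  exists k; rewrite ?inE ?eqxx// => l; rewrite inE => /orP[/eqP->//|/h h2].
  exact: le_trans h2 h'.
have fm0 : f@_m != 0 by rewrite -mcoeff_msupp.
exists (f@_m)^-1; first by rewrite invr_eq0.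
move=> k; rewrite mcoeffZ absM absV.
have [fk|fk] := boolP (k \in msupp f).
  by rewrite mulrC ler_pdivrMr ?abs_gt0// mul1r mx.
by rewrite (memN_msupp_eq0 fk) abs0 mulr0.
Qed.

End Gauss.
End Abs.

(** * Polynomial maps congruent to the Frobenius map *)

Section PolyMaps.
Variables (C : comNzRingType) (n : nat).
Implicit Types (f g : {mpoly C[n]}) (T U : n.-tuple {mpoly C[n]}) (v : 'I_n -> C).

Definition scale_vec (c : C) v : 'I_n -> C := fun i => c * v i.
Definition eval_map T v : 'I_n -> C := fun i => (tnth T i).@[v].
Definition comp_map T U : n.-tuple {mpoly C[n]} := [tuple tnth T i \mPo U | i < n].
Definition iter_map T t : n.-tuple {mpoly C[n]} :=
  iter t (comp_map T) [tuple 'X_i | i < n].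

Lemma scale_vecA c e v : scale_vec c (scale_vec e v) = scale_vec (c * e) v.
Proof. by apply: funext => i; rewrite /scale_vec mulrA. Qed.

Lemma meval_comp T f v : (f \mPo T).@[v] = f.@[eval_map T v].
Proof. exact: comp_mpoly_meval. Qed.

Lemma eval_comp_map T U v : eval_map (comp_map T U) v = eval_map T (eval_map U v).
Proof. by apply: funext => i; rewrite /eval_map tnth_mktuple meval_comp. Qed.

Lemma eval_iter_map T t v : eval_map (iter_map T t) v = iter t (eval_map T) v.
Proof.
elim: t => [|t IH]; first by apply: funext => i; rewrite /eval_map tnth_mktuple mevalXU.
by rewrite /= eval_comp_map IH.
Qed.

Lemma meval_scale f d c v :
  f \is d.-homog -> f.@[scale_vec c v] = c ^+ d * f.@[v].
Proof.
move=> fd; rewrite !mevalE mulr_sumr big_seq [RHS]big_seq; apply: eq_bigr => m mP.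
rewrite mulrCA; congr (_ * _).
have -> : d = (\sum_i m i)%N by rewrite -mdegE; apply/esym; exact: (dhomogP _ _ _ fd).
by rewrite -prodrXr -big_split; apply: eq_bigr => j _; rewrite /= exprMn.
Qed.

Lemma dhomog_prodr (I : Type) (r : seq I) (F : I -> {mpoly C[n]}) (d : I -> nat) :
  (forall i, F i \is (d i).-homog) ->
  \prod_(i <- r) F i \is (\sum_(i <- r) d i).-homog.
Proof.
by move=> h; elim/big_rec2: _ => [|i x y _ hx]; [exact: dhomog1|exact: dhomogM].
Qed.

Lemma dhomog_comp T f d e :
  (forall i, tnth T i \is e.-homog) -> f \is d.-homog -> f \mPo T \is (e * d).-homog.
Proof.
move=> hT fd; rewrite comp_mpolyE big_seq; apply: rpred_sum => m mf.
apply: dhomogZ; rewrite -(dhomogP _ _ _ fd m mf) /= mdegE big_distrr /=.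
by apply: dhomog_prodr => i; exact: dhomogMn.
Qed.

Lemma iter_map_homog T q t i :
  (forall i, tnth T i \is q.-homog) -> tnth (iter_map T t) i \is (q ^ t).-homog.
Proof.
move=> hT; elim: t i => [|t IH] i; first by rewrite tnth_mktuple dhomogX /= mdeg1.
by rewrite /= tnth_mktuple expnSr; apply: dhomog_comp.
Qed.

Lemma eval_map_scale T q c v :
  (forall i, tnth T i \is q.-homog) ->
  eval_map T (scale_vec c v) = scale_vec (c ^+ q) (eval_map T v).
Proof. by move=> hT; apply: funext => i; rewrite /eval_map (meval_scale _ _ (hT i)). Qed.

End PolyMaps.

Section CoefIn.
Variables (C : comNzRingType) (A : C -> Prop).
Hypotheses (A1 : A 1) (AB : forall x y, A x -> A y -> A (x - y)).
Hypothesis AM : forall x y, A x -> A y -> A (x * y).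
Variable n : nat.
Implicit Types (f g : {mpoly C[n]}).

Definition coef_in f := forall m, A f@_m.

Let A0 : A 0. Proof. by rewrite -(subrr 1); exact: AB. Qed.
Let AD x y : A x -> A y -> A (x + y).
Proof. by move=> hx hy; rewrite -[y]opprK -[- y]sub0r; do !apply: AB. Qed.

Lemma coef_inB f g : coef_in f -> coef_in g -> coef_in (f - g).
Proof. by move=> hf hg m; rewrite mcoeffB; exact: AB. Qed.

Lemma coef_inZ c f : A c -> coef_in f -> coef_in (c *: f).
Proof. by move=> hc hf m; rewrite mcoeffZ; exact: AM. Qed.

Lemma coef_inM f g : coef_in f -> coef_in g -> coef_in (f * g).
Proof.
move=> hf hg m; rewrite mcoeffM.
by elim/big_ind: _ => // i _; exact: AM.
Qed.

Lemma coef_in_X m : coef_in 'X_[m].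
Proof. by move=> k; rewrite mcoeffX; case: eqP. Qed.

Lemma coef_in1 : coef_in 1.
Proof. by rewrite -mpolyX0; exact: coef_in_X. Qed.

Lemma coef_inX f k : coef_in f -> coef_in (f ^+ k).
Proof.
move=> hf; elim: k => [|k IH]; first by rewrite expr0; exact: coef_in1.
by rewrite exprS; exact: coef_inM.
Qed.

Lemma coef_in_sum (I : Type) (r : seq I) (F : I -> {mpoly C[n]}) :
  (forall i, coef_in (F i)) -> coef_in (\sum_(i <- r) F i).
Proof.
move=> hF m; rewrite raddf_sum /=.
by elim/big_ind: _ => // i _; exact: hF.
Qed.

Lemma coef_in_comp (T : n.-tuple {mpoly C[n]}) f :
  (forall i, coef_in (tnth T i)) -> coef_in f -> coef_in (f \mPo T).
Proof.
move=> hT hf; rewrite comp_mpolyE; apply: coef_in_sum => m; apply: coef_inZ => //.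
elim/big_ind: _ => // [|x y|i _]; [exact: coef_in1|exact: coef_inM|exact: coef_inX].
Qed.

Lemma coef_in_iter (T : n.-tuple {mpoly C[n]}) t i :
  (forall i, coef_in (tnth T i)) -> coef_in (tnth (iter_map T t) i).
Proof.
move=> hT; elim: t i => [|t IH] i; first by rewrite tnth_mktuple; exact: coef_in_X.
by rewrite /= tnth_mktuple; exact: coef_in_comp.
Qed.

End CoefIn.

(** * Frobenius twists of polynomials *)

Section Twist.
Variables (R : realType) (C : fieldType) (a : C -> R) (p : nat) (n : nat).
Hypotheses (aP : nonarch_abs a) (p_prime : prime p) (p_lt1 : a p%:R < 1).
Implicit Types (f g : {mpoly C[n]}) (T : n.-tuple {mpoly C[n]}) (v : 'I_n -> C).

Let sC := abs_small_ideal aP p_prime p_lt1.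
Let sM := gauss_small_ideal aP n p_prime p_lt1.

(** The Frobenius twist of f: for Q a power of p, its reduction at the Q-th powers of the
    coordinates is the Q-th power of that of f. It transports a closed condition on reductions along
    a lift of Frobenius. *)
Definition twist (Q : nat) f : {mpoly C[n]} :=
  \sum_(m <- msupp f) (f@_m ^+ Q) *: 'X_[m].

Lemma mcoeff_twist Q f m : (0 < Q)%N -> (twist Q f)@_m = f@_m ^+ Q.
Proof.
move=> Q0; rewrite raddf_sum /=.
have [mf|mf] := boolP (m \in msupp f).
  rewrite (bigD1_seq m) //= mcoeffZ mcoeffX eqxx mulr1 big1 ?addr0 // => k /negPf km.
  by rewrite mcoeffZ mcoeffX km mulr0.
rewrite (memN_msupp_eq0 mf) expr0n eqn0Ngt Q0 big_seq big1 // => k kf.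
rewrite mcoeffZ mcoeffX; case: eqP => [e|_]; last by rewrite mulr0.
by rewrite -e kf in mf.
Qed.

Lemma twist_homog Q f d : f \is d.-homog -> twist Q f \is d.-homog.
Proof.
move=> fd; rewrite /twist big_seq; apply: rpred_sum => m mf.
by apply: dhomogZ; rewrite dhomogX (dhomogP _ _ _ fd).
Qed.

Lemma twist_le1 Q f : (0 < Q)%N -> coef_le a f 1 -> coef_le a (twist Q f) 1.
Proof.
move=> Q0 h m; rewrite mcoeff_twist // (absX aP).
by apply: exprn_ile1 (h m); exact: abs_ge0.
Qed.

Definition frob_like T Q := forall i, coef_lt1 a (tnth T i - 'X_i ^+ Q).

Lemma frob_like_le1 T Q : frob_like T Q -> forall i, coef_le a (tnth T i) 1.
Proof.
move=> hT i; apply: (sid_congrS sM (sid_sym sM (hT i))).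
by apply: sid_X sM _ _ _; exact: coef_le_X.
Qed.

(** Modulo small coefficients the p^k-th power is additive, so it may be applied to each term of f,
    and ['X_i ^+ (p ^ k)] may be replaced by the i-th entry of [T]. *)
Lemma twist_comp T k f : frob_like T (p ^ k) -> coef_le a f 1 ->
  coef_lt1 a (twist (p ^ k) f \mPo T - f ^+ (p ^ k)).
Proof.
move=> hT hf; apply: (sid_trans sM) (sid_sym sM _); last first.
  rewrite {1}(mpolyE f); apply: (sid_frob_sum sM) => m.
  by rewrite -mul_mpolyC; apply: (sid_M sM); [exact: coef_le_C|exact: coef_le_X].
rewrite /twist raddf_sum /=; apply: (sid_congr_sum sM) => m.
rewrite exprZn comp_mpolyZ -scalerBr -mul_mpolyC; apply: (sid_IM sM).
  by apply: coef_le_C; rewrite // (absX aP); apply: exprn_ile1 (hf m); exact: abs_ge0.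
rewrite comp_mpolyX mpolyXE_id -prodrXl; apply: (sid_congr_prod sM) => i.
  by apply: sid_X sM _ _ _; exact: frob_like_le1 hT i.
rewrite -exprM mulnC exprM; apply: (sid_congrX sM) => //.
exact: frob_like_le1 hT i.
Qed.

Lemma comp_lt1 T f : (forall i, coef_le a (tnth T i) 1) ->
  coef_lt1 a f -> coef_lt1 a (f \mPo T).
Proof.
move=> hT hf; rewrite comp_mpolyE; apply: (sid_Isum sM) => m _.
rewrite -mul_mpolyC mulrC; apply: (sid_IM sM).
  elim/big_ind: _ => [|x y|i _]; [exact: sid_1 sM|exact: sid_M sM _ _|].
  by apply: sid_X sM _ _ _.
move=> k; rewrite mcoeffC; case: eqP => _; first by rewrite mulr1.
by rewrite mulr0 (abs0 aP).
Qed.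

(** The condition on the coefficients says that the reduction of f is defined over the field with
    p^k elements; thus f is congruent to its own twist. *)
Lemma fixed_comp T k f : frob_like T (p ^ k) -> coef_le a f 1 ->
  (forall m, a (f@_m ^+ (p ^ k) - f@_m) < 1) ->
  coef_lt1 a (f \mPo T - f ^+ (p ^ k)).
Proof.
move=> hT hf hfix; apply: (sid_trans sM) (twist_comp hT hf).
rewrite -raddfB; apply: comp_lt1; first exact: frob_like_le1 hT.
move=> m; rewrite mcoeffB mcoeff_twist ?expn_gt0 ?prime_gt0 //.
by rewrite (abs_distC aP).
Qed.

Lemma iter_frob_like T s t : frob_like T (p ^ s) -> frob_like (iter_map T t) ((p ^ s) ^ t).
Proof.
move=> hT; elim: t => [|t IH] i.
  by rewrite tnth_mktuple expr1 subrr; exact: (sid_I0 sM).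
rewrite /= tnth_mktuple; apply: (sid_trans sM) (_ : coef_lt1 a ('X_i ^+ (p ^ s) \mPo iter_map T t - _)).
  by rewrite -raddfB; apply: comp_lt1 (hT i); exact: frob_like_le1 IH.
rewrite rmorphXn /= comp_mpolyXU -tnth_nth expnSr exprM.
by apply: (sid_congrX sM) (IH i); exact: frob_like_le1 IH i.
Qed.

Lemma abs_lt1_frob_congr T k f g v : coef_lt1 a (g \mPo T - f ^+ (p ^ k)) ->
  (forall i, a (v i) <= 1) -> (a g.@[eval_map T v] < 1) = (a f.@[v] < 1).
Proof.
move=> hfg hv; have := meval_lt1 aP hfg hv; rewrite mevalB meval_comp rmorphXn /= => h.
have Q0 : (0 < p ^ k)%N by rewrite expn_gt0 prime_gt0.
rewrite -[RHS](expr_lt1 Q0) ?abs_ge0 // -(absX aP); apply/idP/idP => h'.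
  by rewrite -(subKr g.@[eval_map T v] (_ ^+ _)) (absB_lt aP).
by rewrite -(subrK (f.@[v] ^+ (p ^ k)) (_.@[_])) (absD_lt aP).
Qed.

Lemma twist_lt1 T k f v : frob_like T (p ^ k) -> coef_le a f 1 ->
  (forall i, a (v i) <= 1) ->
  (a (twist (p ^ k) f).@[eval_map T v] < 1) = (a f.@[v] < 1).
Proof. by move=> hT hf; apply: abs_lt1_frob_congr; exact: twist_comp. Qed.

Lemma fixed_lt1 T k f v : frob_like T (p ^ k) -> coef_le a f 1 ->
  (forall m, a (f@_m ^+ (p ^ k) - f@_m) < 1) ->
  (forall i, a (v i) <= 1) ->
  (a f.@[eval_map T v] < 1) = (a f.@[v] < 1).
Proof. by move=> hT hf hfix; apply: abs_lt1_frob_congr; exact: fixed_comp. Qed.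

Hypothesis residue_alg : forall x, a x <= 1 ->
  exists2 k, (0 < k)%N & a (x ^+ (p ^ k) - x) < 1.

Lemma residue_fixedM x k j : a x <= 1 -> a (x ^+ (p ^ k) - x) < 1 ->
  a (x ^+ (p ^ (k * j)) - x) < 1.
Proof.
move=> hx h; elim: j => [|j IH]; first by rewrite muln0 expr1 subrr (abs0 aP).
rewrite mulnS expnD exprM; apply: (sid_trans sC) IH.
by apply: (sid_congrX sC) h; exact: (sid_X sC).
Qed.

(** Residues fixed by the powers p^k and p^l are all fixed by p^(k l). The multiples [k * j] are
    kept in the conclusion because k is later combined with [s] and with periods. *)
Lemma residue_fixed_seq (s : seq C) : (forall x, x \in s -> a x <= 1) ->
  exists2 k, (0 < k)%N &
    forall x, x \in s -> forall j, a (x ^+ (p ^ (k * j)) - x) < 1.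
Proof.
elim: s => [|x s IH] h; first by exists 1%N.
have [k k0 hk] := IH (fun y ys => h y (mem_behead (s := x :: s) ys)).
have [l l0 hl] := residue_alg (h x (mem_head _ _)).
exists (k * l)%N; first by rewrite muln_gt0 k0.
move=> y; rewrite inE => /orP[/eqP->|ys] j; last by rewrite -mulnA hk.
by rewrite [(k * l)%N]mulnC -mulnA residue_fixedM // h // mem_head.
Qed.

Lemma residue_fixed_mpolys (s : seq {mpoly C[n]}) :
  (forall f, f \in s -> coef_le a f 1) ->
  exists2 k, (0 < k)%N &
    forall f, f \in s -> forall m j, a (f@_m ^+ (p ^ (k * j)) - f@_m) < 1.
Proof.
move=> hs.
have [x|k k0 hk] := @residue_fixed_seq [seq f@_m | f <- s, m <- msupp f].
  by move=> /allpairsPdep[f [m [fs _ ->]]]; exact: hs.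
exists k => // f fs m j; have [mf|mf] := boolP (m \in msupp f).
  by apply: hk; apply/allpairsPdep; exists f, m.
rewrite (memN_msupp_eq0 mf) expr0n expn_eq0 eqn0Ngt prime_gt0 //= subrr.
exact: (sid_I0 sC).
Qed.

End Twist.

(** * Periodic vectors *)

(** Discreteness is stated as a gap in the absolute values below 1: it allows a small element of [K]
    to be divided by [pi] and stay integral. *)
Record discrete_subfield (R : realType) (C : fieldType) (a : C -> R)
    (K : C -> Prop) (pi : C) : Prop := {
  dsf_1 : K 1;
  dsf_B : forall x y, K x -> K y -> K (x - y);
  dsf_M : forall x y, K x -> K y -> K (x * y);
  dsf_V : forall x, K x -> K x^-1;
  dsf_pi : K pi;
  dsf_pi_gt0 : 0 < a pi;
  dsf_pi_lt1 : a pi < 1;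
  dsf_disc : forall x, K x -> a x < 1 -> a x <= a pi
}.

Section PeriodicVectors.
Variables (R : realType) (C : fieldType) (a : C -> R) (p s n : nat).
Hypotheses (aP : nonarch_abs a) (p_prime : prime p) (p_lt1 : a p%:R < 1).
Hypothesis s_gt0 : (0 < s)%N.
Hypothesis residue_alg : forall x, a x <= 1 ->
  exists2 k, (0 < k)%N & a (x ^+ (p ^ k) - x) < 1.
Variable phi : n.-tuple {mpoly C[n]}.
Hypothesis phi_homog : forall i, tnth phi i \is (p ^ s).-homog.
Hypothesis phi_frob : frob_like a phi (p ^ s).
Implicit Types (f g h : {mpoly C[n]}) (v z : 'I_n -> C).

Let sC := abs_small_ideal aP p_prime p_lt1.
Let sM := gauss_small_ideal aP n p_prime p_lt1.

Definition normalized v := (forall i, a (v i) <= 1) /\ exists i, a (v i) = 1.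

Definition periodic_vec v := normalized v /\
  exists2 t, (0 < t)%N & exists c, eval_map (iter_map phi t) v = scale_vec c v.

Let phiT t := eval_map (iter_map phi t).

Lemma iter_phi_homog t i : tnth (iter_map phi t) i \is (p ^ (s * t)).-homog.
Proof. by rewrite expnM; exact: iter_map_homog. Qed.

Lemma iter_phi_frob t : frob_like a (iter_map phi t) (p ^ (s * t)).
Proof. by rewrite expnM; exact: (iter_frob_like aP p_prime p_lt1). Qed.

Lemma phiT_add t u v : phiT (t + u) v = phiT t (phiT u v).
Proof. by rewrite /phiT !eval_iter_map iterD. Qed.

Lemma phiT_scale t c v : phiT t (scale_vec c v) = scale_vec (c ^+ (p ^ (s * t))) (phiT t v).
Proof. by apply: eval_map_scale => i; exact: iter_phi_homog. Qed.

Lemma phiT_normalized t v : normalized v -> normalized (phiT t v).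
Proof.
move=> [v1 [i vi]].
have hle j : a (phiT t v j) <= 1.
  by apply: (meval_le aP) => //; exact: (frob_like_le1 aP p_prime p_lt1 (iter_phi_frob t)).
split=> //; exists i.
have := meval_lt1 aP (iter_phi_frob t i) v1.
rewrite mevalB rmorphXn /= mevalXU (abs_distC aP) => h.
rewrite (@abs_eq_lt _ _ _ aP (v i ^+ (p ^ (s * t)))) (absX aP) vi expr1n //.
Qed.

Lemma normalized_scale v c : normalized v -> normalized (scale_vec c v) -> a c = 1.
Proof.
move=> [v1 [i vi]] [w1 [j wj]]; apply/eqP; rewrite eq_le; apply/andP; split.
  by have := w1 i; rewrite /scale_vec (absM aP) vi mulr1.
rewrite -wj /scale_vec (absM aP) ler_piMr //; exact: abs_ge0.
Qed.

Lemma abs_meval_scale h d c v : h \is d.-homog -> a c = 1 ->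
  a h.@[scale_vec c v] = a h.@[v].
Proof.
by move=> hd c1; rewrite (meval_scale _ _ hd) (absM aP) (absX aP) c1 expr1n mul1r.
Qed.

Lemma phiT_iter_scale t c v k : phiT t v = scale_vec c v ->
  exists d, phiT (t * k) v = scale_vec d v.
Proof.
move=> h; elim: k => [|k [d IH]].
  exists 1; rewrite muln0; apply: funext => i.
  by rewrite /phiT eval_iter_map /= /scale_vec mul1r.
exists (d ^+ (p ^ (s * t)) * c).
by rewrite mulnS phiT_add IH phiT_scale h scale_vecA.
Qed.

Lemma periodic_phiT t v : periodic_vec v -> periodic_vec (phiT t v).
Proof.
move=> [nv [r r0 [c h]]]; split; first exact: phiT_normalized.
exists r => //; exists (c ^+ (p ^ (s * t))).
by rewrite -/(phiT r _) -phiT_add addnC phiT_add [phiT r v]h phiT_scale.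
Qed.

Lemma periodic_phiT_mul v : periodic_vec v -> exists2 r, (0 < r)%N &
  forall k, exists2 c, a c = 1 & phiT (k * r) v = scale_vec c v.
Proof.
move=> [nv [r r0 [c h]]]; exists r => // k.
have [d hd] := phiT_iter_scale k h; exists d; last by rewrite mulnC.
by apply: (normalized_scale nv); rewrite -hd; exact: phiT_normalized.
Qed.

Lemma periodic_preimage t v : periodic_vec v ->
  exists2 z, periodic_vec z & exists2 c, a c = 1 & phiT t z = scale_vec c v.
Proof.
move=> pv; have [r r0 hr] := periodic_phiT_mul pv.
(* Together with t this makes [t * r] iterations, a multiple of the period: F^t permutes the
   periodic points. *)
exists (phiT (t * r.-1) v); first exact: periodic_phiT.
rewrite -phiT_add -mulnS prednK //; exact: hr.
Qed.

Section Local.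
Variables (K : C -> Prop) (pi : C) (M : nat).
Hypothesis KP : discrete_subfield a K pi.

(** The ring K° + pi^j C°; j counts the divisions by [pi] that remain possible. *)
Definition near_subfield j x := a x <= 1 /\ exists2 y, K y & a (x - y) <= a pi ^+ j.

Hypothesis phi_near : forall i, coef_in (near_subfield M) (tnth phi i).

Let pi_ge0 : 0 <= a pi. Proof. exact: abs_ge0. Qed.
Let pi_le1 : a pi <= 1. Proof. exact/ltW/(dsf_pi_lt1 KP). Qed.

Lemma near_subfieldW j k x : (j <= k)%N -> near_subfield k x -> near_subfield j x.
Proof.
move=> jk [x1 [y Ky h]]; split=> //; exists y => //.
by apply: le_trans h _; apply: ler_wiXn2l.
Qed.

Lemma near_subfield1 j : near_subfield j 1.
Proof.
split; first by rewrite (abs1 aP).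
by exists 1; [exact: (dsf_1 KP)|rewrite subrr (abs0 aP) exprn_ge0].
Qed.

Lemma near_subfieldB j x y :
  near_subfield j x -> near_subfield j y -> near_subfield j (x - y).
Proof.
move=> [x1 [x' Kx hx]] [y1 [y' Ky hy]]; split; first exact: absB_le.
exists (x' - y'); first exact: (dsf_B KP).
have -> : x - y - (x' - y') = x - x' - (y - y') by ring.
exact: absB_le.
Qed.

Lemma near_subfieldM j x y :
  near_subfield j x -> near_subfield j y -> near_subfield j (x * y).
Proof.
move=> [x1 [x' Kx hx]] [y1 [y' Ky hy]]; split.
  by rewrite (absM aP) mulr_ile1 //; exact: abs_ge0.
exists (x' * y'); first exact: (dsf_M KP).
have x'1 : a x' <= 1.
  rewrite -[x'](subKr x); apply: absB_le => //; apply: le_trans hx _.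
  exact: exprn_ile1.
rewrite -(subrKA (x' * y)) -mulrBl -mulrBr; apply: absD_le => //.
  by rewrite (absM aP); apply: le_trans hx; apply: ler_piMr => //; exact: abs_ge0.
by rewrite (absM aP); apply: le_trans hy; apply: ler_piMl => //; exact: abs_ge0.
Qed.

Lemma near_subfield_div j x : near_subfield j.+1 x -> a x < 1 ->
  near_subfield j (pi^-1 * x).
Proof.
move=> [x1 [y Ky h]] xlt1; have pi0 := dsf_pi_gt0 KP.
(* The approximation [y] is small and lies in [K], so discreteness provides a factor [pi]; the error
   is at most |pi|^(j+1) and has this factor too. *)
have hpi : a y <= a pi.
  apply: (dsf_disc KP) => //; rewrite -[y](subKr x); apply: absB_lt => //.
  by apply: le_lt_trans h _; rewrite expr_lt1 //; exact: (dsf_pi_lt1 KP).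
have hx : a x <= a pi.
  rewrite -[x](subrK y); apply: absD_le => //; apply: le_trans h _.
  by rewrite exprS ler_piMr // exprn_ile1.
split; first by rewrite (absM aP) (absV aP) mulrC ler_pdivrMr // mul1r.
exists (pi^-1 * y); first by apply: (dsf_M KP) => //; apply: (dsf_V KP); exact: (dsf_pi KP).
by rewrite -mulrBr (absM aP) (absV aP) mulrC ler_pdivrMr // -exprSr.
Qed.

Lemma near_coef_le1 j f : coef_in (near_subfield j) f -> coef_le a f 1.
Proof. by move=> h m; have [] := h m. Qed.

(* An element of absolute value < 1 of K° + pi^(j+1) C° is pi times an element of
   K° + pi^j C°. *)
Lemma frob_expand j h d t : (j < M)%N ->
  coef_in (near_subfield j.+1) h -> h \is d.-homog ->
  (forall m, a (h@_m ^+ (p ^ (s * t)) - h@_m) < 1) ->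
  exists h1, [/\ coef_in (near_subfield j) h1,
    h1 \is (p ^ (s * t) * d).-homog &
    h \mPo iter_map phi t = h ^+ (p ^ (s * t)) + pi *: h1].
Proof.
move=> jM hh hd hfix; set Q := (p ^ (s * t))%N.
have ns1 := near_subfield1 j.+1; have nsB := @near_subfieldB j.+1.
have nsM := @near_subfieldM j.+1.
exists (pi^-1 *: (h \mPo iter_map phi t - h ^+ Q)).
have pi0 : pi != 0 by rewrite -(abs_gt0 aP); exact: (dsf_pi_gt0 KP).
split; last by rewrite scalerA divff // scale1r addrC subrK.
  move=> m; rewrite mcoeffZ; apply: near_subfield_div.
    apply: (coef_inB nsB); last exact: coef_inX.
    apply: coef_in_comp => // i; apply: coef_in_iter => // k m'.
    exact: near_subfieldW (phi_near k m').
  apply: (fixed_comp aP p_prime p_lt1 _ _ hfix) => //.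
    exact: iter_phi_frob.
  exact: near_coef_le1 hh.
apply: dhomogZ; apply: rpredB; last by rewrite mulnC; exact: dhomogMn.
by apply: dhomog_comp => // i; exact: iter_phi_homog.
Qed.

Lemma fixed_exponent (hs : seq {mpoly C[n]}) :
  (forall h, h \in hs -> coef_le a h 1) ->
  exists2 k, (0 < k)%N & forall h, h \in hs -> forall m j,
    a (h@_m ^+ (p ^ (s * (k * j))) - h@_m) < 1.
Proof.
move=> /(residue_fixed_mpolys aP p_prime p_lt1 residue_alg)[k k0 hk].
by exists k => // h hh m j; rewrite mulnCA; exact: hk.
Qed.

Let Q_gt1 t : (0 < t)%N -> (1 < p ^ (s * t))%N.
Proof.
by move=> t0; rewrite -(expn0 p) ltn_exp2l ?prime_gt1 // muln_gt0 s_gt0.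
Qed.

(* Expanding h along a full period gives |h(z)| <= max(|h(z)|^Q, |pi|). *)
Lemma periodic_small j h d z : (j < M)%N ->
  coef_in (near_subfield j.+1) h -> h \is d.-homog -> periodic_vec z ->
  a h.@[z] < 1 -> a h.@[z] <= a pi.
Proof.
move=> jM hh hd pz hz; rewrite leNgt; apply/negP => hpi.
have h1 := near_coef_le1 hh.
have [k k0 hk] : exists2 k, (0 < k)%N & forall h', h' \in [:: h] -> forall m j,
    a (h'@_m ^+ (p ^ (s * (k * j))) - h'@_m) < 1.
  by apply: fixed_exponent => h'; rewrite inE => /eqP->.
(* The exponent [k * r] is a multiple of the period, so that z returns to [c] times itself, and of
   k, so that the reduction of h is fixed. *)
have [r r0 /(_ k)[c c1 hc]] := periodic_phiT_mul pz.
have [m|g [gn gh e]] := frob_expand (t := (k * r)%N) jM hh hd.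
  by apply: hk; rewrite mem_head.
have [[z1 _] _] := pz.
have := congr1 (fun f => a f.@[z]) e; rewrite /= meval_comp -/(phiT _ _) hc.
rewrite (abs_meval_scale _ hd c1) mevalD rmorphXn /= mevalZ => e'.
have g1 : a (pi * g.@[z]) <= a pi.
  rewrite (absM aP) ler_piMr //; apply: meval_le => //; exact: near_coef_le1 gn.
have h0 : 0 < a h.@[z] by apply: le_lt_trans hpi; exact: abs_ge0.
suff : a h.@[z] < a h.@[z] by rewrite ltxx.
rewrite {1}e'; apply: absD_lt => //; last exact: le_lt_trans g1 hpi.
rewrite (absX aP) -[ltRHS]expr1 ltr_iXn2l // Q_gt1 // muln_gt0 k0 //.
Qed.

(** Periodicity enters twice: v has a preimage z under F^t, and [periodic_small] improves |h(z)| < 1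
    to |h(z)| <= |pi|. Then h(z)^Q is negligible in h(z)^Q + pi g(z) once Q > j, and only g(z) has
    to be controlled, at precision j. For j = 0 there is no condition, as h is integral. *)
Lemma approx_closed j h d : (j <= M)%N ->
  coef_in (near_subfield j) h -> h \is d.-homog ->
  exists J : {mpoly C[n]} -> Prop,
    (forall g, J g -> coef_le a g 1 /\ exists e, g \is e.-homog) /\
    (forall v, periodic_vec v ->
      a h.@[v] <= a pi ^+ j <-> forall g, J g -> a g.@[v] < 1).
Proof.
elim: j h d => [|j IH] h d jM hh hd.
  exists (fun=> False); split=> // v [[v1 _] _]; split=> // _.
  by rewrite expr0; apply: meval_le => //; exact: near_coef_le1 hh.
have h1 := near_coef_le1 hh.
have [k k0 hk] : exists2 k, (0 < k)%N & forall h', h' \in [:: h] -> forall m j,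
    a (h'@_m ^+ (p ^ (s * (k * j))) - h'@_m) < 1.
  by apply: fixed_exponent => h'; rewrite inE => /eqP->.
(* The factor k makes the power of Frobenius fix the reduction of h; the factor [j.+1] ensures Q >=
   j + 1, hence |pi|^Q <= |pi|^(j+1). *)
have [m|g [gn gh e]] := frob_expand (t := (k * j.+1)%N) jM hh hd.
  by apply: hk; rewrite mem_head.
move: gh e; set t := (k * j.+1)%N; set Q := (p ^ (s * t))%N => gh e.
have Q0 : (0 < Q)%N by rewrite expn_gt0 prime_gt0.
have jQ : (j.+1 <= Q)%N.
  apply: leq_trans (ltnW (ltn_expl j.+1 (prime_gt1 p_prime))) _.
  by rewrite leq_exp2l ?prime_gt1 // /t mulnA leq_pmull // muln_gt0 s_gt0.
have [J [J1 J2]] := IH g _ (ltnW jM) gn gh.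
(* The induction hypothesis gives conditions on z. Up to a scalar of absolute value 1, v is the
   image of z under F^t, so twisting turns them into conditions on v. *)
exists (fun f => f = h \/ exists2 g', J g' & f = twist Q g'); split.
  move=> f [->|[g' /J1[g1 [e' ge]] ->]]; first by split=> //; exists d.
  by split; [exact: twist_le1|exists e'; exact: twist_homog].
move=> v pv; have [z pz [c c1 hz]] := periodic_preimage t pv.
have [[z1 _] _] := pz.
have hvz : a h.@[v] = a (h.@[z] ^+ Q + pi * g.@[z]).
  rewrite -(abs_meval_scale v hd c1) -hz -meval_comp e.
  by rewrite mevalD rmorphXn /= mevalZ.
have twz g' : J g' -> (a (twist Q g').@[v] < 1) = (a g'.@[z] < 1).
  move=> Jg; have [g'1 [e' ge]] := J1 _ Jg.
  rewrite -(abs_meval_scale v (twist_homog Q ge) c1) -hz.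
  exact: (twist_lt1 aP p_prime p_lt1 (iter_phi_frob t)).
have small : a h.@[v] < 1 -> a (h.@[z] ^+ Q) <= a pi ^+ j.+1.
  rewrite -(abs_meval_scale v hd c1) -hz => hv.
  have /(periodic_small jM hh hd pz) hz1 : a h.@[z] < 1.
    rewrite -(fixed_lt1 aP p_prime p_lt1 (iter_phi_frob t) h1) // => m.
    by apply: hk; rewrite mem_head.
  rewrite (absX aP); apply: (@le_trans _ _ (a pi ^+ Q)).
    by apply: lerXn2r => //; rewrite nnegrE //; exact: abs_ge0.
  exact: ler_wiXn2l.
have pi0 := dsf_pi_gt0 KP.
split=> [hv f [->|[g' Jg' ->]]|hJ].
- by apply: le_lt_trans hv _; rewrite expr_lt1 //; exact: (dsf_pi_lt1 KP).
- rewrite twz //; apply: (J2 z pz).1 Jg'.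
  have hv1 : a h.@[v] < 1.
    by apply: le_lt_trans hv _; rewrite expr_lt1 //; exact: (dsf_pi_lt1 KP).
  have : a (pi * g.@[z]) <= a pi ^+ j.+1.
    rewrite -[pi * _](addKr (h.@[z] ^+ Q)) addrC; apply: absB_le => //.
      by rewrite -hvz.
    exact: small.
  by rewrite (absM aP) exprS ler_pM2l.
have hv1 : a h.@[v] < 1 by apply: hJ; left.
rewrite hvz; apply: absD_le => //; first exact: small.
rewrite (absM aP) exprS ler_pM2l //; apply/(J2 z pz) => g' Jg'.
by rewrite -twz //; apply: hJ; right; exists g'.
Qed.

End Local.
End PeriodicVectors.

(** * Noetherianity *)

Lemma nondecreasing_subseq (w : nat -> nat) : exists f : nat -> nat,
  (forall i j, (i < j)%N -> (f i < f j)%N) /\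
  (forall i j, (i <= j)%N -> (w (f i) <= w (f j))%N).
Proof.
(* [m N] is an index where [w] reaches its minimum over all indices >= N; iterating from the
   successor of the previous index gives the subsequence. *)
have /choice[m hm] : forall N, exists m, (N <= m)%N /\
    forall k, (N <= k)%N -> (w m <= w k)%N.
  move=> N; have ex : exists v, `[< exists2 m, (N <= m)%N & w m = v >].
    by exists (w N); apply/asboolP; exists N.
  case: (ex_minnP ex) => v /asboolP[m Nm wm] vmin; exists m; split=> // k Nk.
  by rewrite wm; apply: vmin; apply/asboolP; exists k.
pose f := fix f i := if i is i'.+1 then m (f i').+1 else m 0%N.
have f_lt i : (f i < f i.+1)%N by have [] := hm (f i).+1.
have f_min i k : (f i <= k)%N -> (w (f i) <= w k)%N.
  case: i => [|i] h; first by apply: (hm 0%N).2.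
  by apply: (hm (f i).+1).2; apply: leq_trans h; exact: f_lt.
have f_mono i j : (i <= j)%N -> (f i <= f j)%N.
  move=> /subnK <-; elim: (j - i)%N => // k IH.
  by apply: leq_trans IH _; rewrite addSn ltnW.
exists f; split=> i j ij; last exact/f_min/f_mono.
exact: leq_trans (f_lt i) (f_mono _ _ ij).
Qed.

Lemma dickson n (u : nat -> 'X_{1..n}) :
  exists i j, (i < j)%N /\ (u i <= u j)%MM.
Proof.
have [f [f_lt hf]] : exists f : nat -> nat, (forall i j, (i < j)%N -> (f i < f j)%N) /\
    (forall k, k \in enum 'I_n -> forall i j, (i <= j)%N -> (u (f i) k <= u (f j) k)%N).
  elim: (enum 'I_n) => [|k s [f [f_lt hf]]]; first by exists id; split.
  have [g [g_lt hg]] := nondecreasing_subseq (fun i => u (f i) k).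
  exists (f \o g); split=> [i j /g_lt/f_lt //|l].
  rewrite inE => /orP[/eqP->|ls] i j ij; first exact: hg.
  apply: hf => //; move: ij; rewrite leq_eqVlt => /orP[/eqP->//|/g_lt].
  exact: ltnW.
exists (f 0%N), (f 1%N); split; first exact: f_lt.
by apply/mnm_lepP => k; apply: hf; rewrite ?mem_enum.
Qed.

Section Noetherian.
Variables (R : realType) (C : fieldType) (a : C -> R) (n : nat).
Hypothesis aP : nonarch_abs a.
Implicit Types (f g h : {mpoly C[n]}) (v : 'I_n -> C) (s : seq {mpoly C[n]}).

Let integral v := forall i, a (v i) <= 1.
(** The integral polynomials whose reduction vanishes wherever those of [s] do. This set replaces an
    ideal of polynomials over the residue field. *)
Let cut s h := coef_le a h 1 /\
  forall v, integral v -> (forall f, f \in s -> a f.@[v] < 1) -> a h.@[v] < 1.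

(** A representative of the reduction of f without small nonzero coefficients, so that its leading
    monomial is that of the reduction. *)
Definition unit_part f : {mpoly C[n]} :=
  \sum_(m <- msupp f | a f@_m == 1) f@_m *: 'X_[m].

Lemma mcoeff_unit_part f m :
  (unit_part f)@_m = if a f@_m == 1 then f@_m else 0.
Proof.
rewrite /unit_part raddf_sum /=.
have [mf|mf] := boolP (m \in msupp f); last first.
  rewrite (memN_msupp_eq0 mf) if_same big_seq_cond big1 // => k /andP[kf _].
  rewrite mcoeffZ mcoeffX; case: eqP => [e|_]; last by rewrite mulr0.
  by rewrite -e kf in mf.
rewrite -big_filter; case: ifP => h.
  rewrite (bigD1_seq m) /= ?mem_filter ?h ?mf ?filter_uniq //.
  rewrite mcoeffZ mcoeffX eqxx mulr1 big1 ?addr0 // => k /negPf km.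
  by rewrite mcoeffZ mcoeffX km mulr0.
rewrite big_seq big1 // => k; rewrite mem_filter => /andP[hk _].
rewrite mcoeffZ mcoeffX; case: eqP => [e|_]; last by rewrite mulr0.
by rewrite -e hk in h.
Qed.

Lemma unit_part_lt1 f : coef_le a f 1 -> coef_lt1 a (f - unit_part f).
Proof.
move=> h m; rewrite mcoeffB mcoeff_unit_part; case: eqP => [_|/eqP ne].
  by rewrite subrr (abs0 aP).
by rewrite subr0 lt_neqAle ne; exact: h.
Qed.

Let unit_part_le f : coef_le a f 1 -> coef_le a (unit_part f) 1.
Proof.
move=> h m; rewrite mcoeff_unit_part; case: eqP => [->//|_].
by rewrite (abs0 aP).
Qed.

Let cut_congr s f g : coef_le a g 1 -> coef_lt1 a (f - g) -> cut s f -> cut s g.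
Proof.
move=> hg h [hf1 hf2]; split=> // v hv hs.
rewrite -[g](subKr f) mevalB; apply: (absB_lt aP); first exact: hf2.
exact: meval_lt1.
Qed.

(* Each step of a strictly increasing chain of ideals contributes a polynomial
   of minimal leading monomial; by Dickson's lemma one of these monomials
   divides a later one, and a division step contradicts minimality. *)
Lemma finite_cut (J : {mpoly C[n]} -> Prop) : (forall g, J g -> coef_le a g 1) ->
  exists2 s : seq {mpoly C[n]}, (forall g, g \in s -> J g) &
    forall v, integral v -> (forall g, g \in s -> a g.@[v] < 1) ->
      forall g, J g -> a g.@[v] < 1.
Proof.
move=> hJ; apply: contrapT => noJ.
(* Since no finite part of [J] suffices, each list of elements of [J] misses one; on other lists the
   value of [next] is arbitrary. *)
have /choice[next hnext] : forall s : seq {mpoly C[n]}, exists g, (forall f, f \in s -> J f) ->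
    J g /\ ~ cut s g.
  move=> s; apply: contrapT => h; apply: noJ; exists s.
    by apply: contrapT => hs; apply: h; exists 0 => /hs.
  move=> v hv hs g Jg; apply: contrapT => hg; apply: h; exists g => _; split=> //.
  by move=> [_ /(_ v hv hs)].
pose sig k := iter k (fun s => next s :: s) [::].
have sigJ k : forall f, f \in sig k -> J f.
  elim: k => //= k IH f; rewrite inE => /orP[/eqP->|/IH//].
  by have [] := hnext _ IH.
have sig_sub i j : (i <= j)%N -> forall f, f \in sig i -> f \in sig j.
  by move=> /subnK <- f fi; elim: (j - i)%N => //= k IH; rewrite inE IH orbT.
have cut_sub i j f : (i <= j)%N -> cut (sig i) f -> cut (sig j) f.
  move=> ij [f1 hf]; split=> // v hv hs; apply: hf => // g gi.
  exact/hs/(sig_sub _ _ ij).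
pose good k h := [/\ cut (sig k.+1) h, ~ cut (sig k) h &
  forall m, h@_m = 0 \/ a h@_m = 1].
have good_unit k h : cut (sig k.+1) h -> ~ cut (sig k) h -> good k (unit_part h).
  move=> hc hn; have h1 := hc.1; split.
  - apply: cut_congr hc; first exact: unit_part_le.
    exact: unit_part_lt1.
  - move=> hu; apply: hn; apply: cut_congr hu => // m.
    by rewrite -opprB mcoeffN (absN aP); exact: unit_part_lt1.
  - by move=> m; rewrite mcoeff_unit_part; case: eqP; [right|left].
have /choice[h hh] : forall k, exists h, good k h /\
    forall g, good k g -> ~ (mlead g < mlead h)%O.
  move=> k; have [h0 gh0] : exists h, good k h.
    have [Jn nc] := hnext _ (@sigJ k); exists (unit_part (next (sig k))).
    apply: good_unit => //; split; first exact: hJ.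
    by move=> v _ hs; apply: hs; rewrite /= mem_head.
  have [m em] : exists m, m = mlead h0 by exists (mlead h0).
  elim/(well_founded_ind (@ltom_wf n)): m h0 gh0 em => m IH h0 gh0 em.
  have [[g [gg lg]]|none] := pselect (exists g, good k g /\ (mlead g < mlead h0)%O).
    by apply: (IH (mlead g)) gg erefl; rewrite em.
  exists h0; split=> // g gg lg; apply: none; by exists g.
have [i [j [ij le_ij]]] := dickson (fun k => mlead (h k)).
have [[ci ni ui] _] := hh i; have [[cj nj uj] minj] := hh j.
have cut0 s : cut s 0.
  split; first by apply: coef_le0.
  by move=> v _ _; rewrite meval0 (abs0 aP).
have hi0 : h i != 0 by apply/eqP => e; apply: ni; rewrite e.
have hj0 : h j != 0 by apply/eqP => e; apply: nj; rewrite e.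
have ai : a (mleadc (h i)) = 1.
  by case: (ui (mlead (h i))) => // /eqP; rewrite mleadc_eq0 (negPf hi0).
have aj : a (mleadc (h j)) = 1.
  by case: (uj (mlead (h j))) => // /eqP; rewrite mleadc_eq0 (negPf hj0).
have ci0 : mleadc (h i) != 0 by rewrite -(abs_eq0 aP) ai oner_eq0.
(* Both leading coefficients are units, so [t] below is integral. As i < j, it lies in
   [cut (sig j)]; subtracting it from [h j] cancels the leading term and leaves a polynomial that is
   still new at step j. *)
pose c := mleadc (h j) / mleadc (h i).
have ac : a c = 1 by rewrite (absM aP) (absV aP) ai aj divr1.
pose m := (mlead (h j) - mlead (h i))%MM.
pose t := c *: 'X_[m] * h i.
have t1 : coef_le a (c *: 'X_[m]) 1.
  by rewrite -[1]mulr1 -{1}ac; apply: coef_leZ => //; exact: coef_le_X.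
have ct : cut (sig j) t.
  have [hi1 hi2] := cut_sub _ _ _ ij ci; split.
    by rewrite -[1]mulr1; apply: coef_leM.
  move=> v hv hs; rewrite mevalM (absM aP).
  apply: le_lt_trans (hi2 v hv hs); apply: ler_piMl; first exact: abs_ge0.
  by apply: (meval_le aP).
have lt : mlead t = mlead (h j).
  rewrite /t -scalerAl mleadZ ?divf_neq0 //; last first.
    by rewrite -(abs_eq0 aP) ac oner_eq0.
  rewrite mleadM ?mleadXm ?submK // -msupp_eq0 msuppX //.
have tj : t@_(mlead (h j)) = mleadc (h j).
  have -> : t = c *: (h i * 'X_[m]) by rewrite /t -scalerAl mulrC.
  have {1}-> : mlead (h j) = (m + mlead (h i))%MM by rewrite submK.
  by rewrite mcoeffZ mcoeffMX divfK.
have hd : good j (unit_part (h j - t)).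
  apply: good_unit.
    have [cj1 cj2] := cj; have [ct1 ct2] := cut_sub _ _ _ (leqnSn j) ct.
    split; first exact: coef_leB.
    by move=> v hv hs; rewrite mevalB; apply: (absB_lt aP); [exact: cj2|exact: ct2].
  move=> [d1 d2]; apply: nj; have [ct1 ct2] := ct; split; first exact: cj.1.
  move=> v hv hs; rewrite -(subrK t (h j)) mevalD.
  by apply: (absD_lt aP); [exact: d2|exact: ct2].
apply: (minj _ hd); have [_ nd _] := hd.
set u := unit_part _ in nd *.
have u0 : u != 0 by apply/eqP => e; apply: nd; rewrite e.
have := mlead_supp u0; rewrite mcoeff_msupp mcoeff_unit_part.
case: ifP => [_ nz|]; last by rewrite eqxx.
rewrite lt_neqAle; apply/andP; split.
  by apply: contraNneq nz => e; rewrite -/u e mcoeffB tj subrr.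
apply: le_trans (msupp_le_mlead _) _; first by rewrite mcoeff_msupp; exact: nz.
by apply: le_trans (mleadB_le _ _) _; rewrite lt joinxx.
Qed.

End Noetherian.

(** * Discretely valued fields *)

Lemma expr_small (R : realType) (x e : R) : 0 <= x < 1 -> 0 < e ->
  exists n, x ^+ n < e.
Proof.
move=> /andP[x0 x1] e0; have [->|xn0] := eqVneq x 0.
  by exists 1%N; rewrite expr0n.
have xp : 0 < x by rewrite lt_neqAle eq_sym xn0.
pose y := x^-1 - 1; have y0 : 0 < y by rewrite subr_gt0 invf_gt1.
have bern n : n%:R * y <= (x^-1) ^+ n.
  suff : 1 + n%:R * y <= (x^-1) ^+ n by apply: le_trans; rewrite lerDr.
  elim: n => [|n IH]; first by rewrite mul0r addr0 expr0.
  have -> : x^-1 = 1 + y by rewrite /y addrC subrK.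
  move: IH; have -> : x^-1 = 1 + y by rewrite /y addrC subrK.
  move=> IH; rewrite exprS mulrDl mul1r -natr1 mulrDl mul1r addrA.
  apply: lerD => //; apply: ler_peMr; first exact: ltW.
  by apply: le_trans IH; rewrite lerDl mulr_ge0 // ltW.
have := archi_boundP (x := (e * y)^-1); rewrite invr_ge0 mulr_ge0 ?ltW // => /(_ isT).
set n := Num.bound _ => hn; exists n.
have : e^-1 < (x^-1) ^+ n.
  apply: lt_le_trans (bern n); move: hn.
  by rewrite invfM [n%:R * _]mulrC -ltr_pdivrMl // mulrC.
by rewrite exprVn ltf_pV2 // posrE // exprn_gt0.
Qed.

Lemma linear_dependence (F : fieldType) d (A : 'M[F]_(d.+1, d)) :
  exists2 u : 'rV_d.+1, u != 0 & u *m A = 0.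
Proof.
have h : kermx A != 0.
  by rewrite kermx_eq0 /row_free neq_ltn ltnS rank_leq_col.
exists (nz_row (kermx A)); first by rewrite nz_row_eq0.
by apply/sub_kermxP; exact: nz_row_sub.
Qed.

Section DiscreteValuation.
Variables (R : realType) (L : fieldType) (b : L -> R).
Hypothesis bP : nonarch_abs b.

Definition discrete_embedding (K : fieldType) (i : {rmorphism K -> L}) :=
  exists pi : K, [/\ 0 < b (i pi), b (i pi) < 1 &
    forall x, x != 0 -> b (i x) <= 1 -> exists k : nat, b (i x) = b (i pi) ^+ k].

(** If the largest absolute value were attained only once, that term would dominate the sum. *)
Lemma two_equal_terms m (F : 'I_m -> L) : \sum_j F j = 0 -> (exists j, F j != 0) ->
  exists j k : 'I_m, [/\ (j < k)%N, F j != 0 & b (F j) = b (F k)].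
Proof.
move=> sF [j0 Fj0].
case: (arg_maxP (fun j => b (F j)) (erefl : xpredT j0)) => j _ hj0.
have hj k : b (F k) <= b (F j) by exact: hj0.
have Fj : F j != 0.
  by rewrite -(abs_gt0 bP); apply: lt_le_trans (hj j0); rewrite (abs_gt0 bP).
have [k kj bk] : exists2 k, k != j & b (F k) = b (F j).
  apply: contrapT => no.
  have h k : k != j -> b (F k) < b (F j).
    move=> kj; rewrite lt_neqAle hj andbT; apply/eqP => e.
    by apply: no; exists k.
  move: sF; rewrite (bigD1 j) //= => /eqP; rewrite addr_eq0 => /eqP e.
  have : b (F j) < b (F j).
    rewrite {1}e (absN bP); apply: (abs_sum_lt bP); first by rewrite (abs_gt0 bP).
    by move=> k; exact: h.
  by rewrite ltxx.
have Fk : F k != 0 by rewrite -(abs_gt0 bP) bk (abs_gt0 bP).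
have [jk|kj'|e] := ltngtP j k; first by exists j, k.
  by exists k, j.
by move: kj; rewrite (val_inj e) eqxx.
Qed.

(* In a linear relation between the powers of x, two terms have the same absolute
   value; hence |x|^(d!) is the absolute value of an element of K. *)
Lemma discrete_adjoin (K : fieldType) (i : {rmorphism K -> L}) (z : L) :
  discrete_embedding i -> algebraicOver i z ->
  exists (K' : fieldType) (i' : {rmorphism K' -> L}),
    [/\ discrete_embedding i', forall x, exists y, i' y = i x & exists y, i' y = z].
Proof.
move=> [pi [pi0 pi1 hpi]] [f f0 fz]; pose K' : fieldType := subFExtend i z f.
pose i' : {rmorphism K' -> L} := @subfx_inj K L i z f.
have ev q : i' (subfx_eval i z f q) = (map_poly i q).[z] by exact: subfx_inj_eval.
have ext x : exists y, i' y = i x.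
  by exists (subfx_eval i z f x%:P); rewrite ev map_polyC hornerC.
exists K', i'; split=> //; last first.
  by exists (subfx_root i z f); exact: subfx_inj_root.
pose d := (size f).-1.
have d0 : (0 < d)%N.
  by rewrite /d -subn1 subn_gt0 -(size_map_poly i) (root_size_gt1 _ fz) ?map_poly_eq0.
have df : d.+1 = size f by rewrite prednK // size_poly_gt0.
have power x : x != 0 -> exists c, c != 0 /\ b (i' x) ^+ d`! = b (i c).
  move=> x0; have /choice[g hg] : forall j : 'I_d.+1, exists g, x ^+ j = subfx_eval i z f g.
    by move=> j; exact: subfxE.
  have hg' (j : 'I_d.+1) : i' x ^+ j = (map_poly i (g j %% f)).[z].
    rewrite -rmorphXn hg ev {1}(divp_eq (g j) f) rmorphD rmorphM /=.
    by rewrite hornerD hornerM (rootP fz) mulr0 add0r.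
  have sz (j : 'I_d.+1) : (size (g j %% f)%R <= d)%N by rewrite -ltnS df ltn_modp.
  have [u u0 uA] := linear_dependence (\matrix_j poly_rV (d := d) (g j %% f)).
  have sum0 : \sum_j u 0 j *: (g j %% f) = 0.
    transitivity (rVpoly (u *m \matrix_j poly_rV (d := d) (g j %% f))).
      rewrite mulmx_sum_row raddf_sum /=; apply: eq_bigr => j _.
      by rewrite rowK linearZ /= poly_rV_K.
    by rewrite uA linear0.
  have x'0 : i' x != 0 by rewrite fmorph_eq0.
  have [||j [k [jk]]] := @two_equal_terms d.+1 (fun j => i (u 0 j) * i' x ^+ j).
  - transitivity (map_poly i (\sum_j u 0 j *: (g j %% f))).[z].
      rewrite raddf_sum /= horner_sum; apply: eq_bigr => j _.
      by rewrite map_polyZ /= hornerZ -hg'.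
    by rewrite sum0 rmorph0 horner0.
  - have /rV0Pn[j uj] := u0; exists j.
    by rewrite mulf_neq0 ?expf_neq0 // fmorph_eq0.
  rewrite mulf_eq0 negb_or fmorph_eq0 => /andP[uj _] e.
  have uk : u 0 k != 0.
    rewrite -(fmorph_eq0 i) -(abs_gt0 bP).
    have : 0 < b (i (u 0 k) * i' x ^+ k).
      by rewrite -e (abs_gt0 bP) mulf_neq0 ?expf_neq0 // fmorph_eq0.
    rewrite (absM bP) => h; rewrite lt_neqAle (abs_ge0 bP) andbT.
    by apply: contraTneq h => <-; rewrite mul0r ltxx.
  have kj : (0 < k - j <= d)%N.
    by rewrite subn_gt0 jk leq_subLR -ltnS (leq_trans (ltn_ord k)) // ltnS leq_addl.
  have hx : b (i' x) ^+ (k - j) = b (i (u 0 j / u 0 k)).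
    rewrite fmorph_div (absM bP) (absV bP).
    have nz y : y != 0 -> b y != 0 by rewrite (abs_eq0 bP).
    have xj : b (i' x) ^+ j != 0 by rewrite expf_neq0 // nz.
    have iuk : b (i (u 0 k)) != 0 by rewrite nz // fmorph_eq0.
    apply: (mulIf xj); rewrite -exprD subnK ?(ltnW jk) // mulrAC.
    move: e; rewrite !(absM bP) !(absX bP) => ->.
    by rewrite mulrAC divff // mul1r.
  (* The gap [k - j] depends on x, but it is at most d and so divides d!, which serves for all x. *)
  have /dvdnP[c hc] := dvdn_fact kj.
  exists ((u 0 j / u 0 k) ^+ c); split; first by rewrite expf_neq0 // mulf_neq0 ?invr_eq0.
  by rewrite hc mulnC exprM hx rmorphXn /= (absX bP).
pose D := d`!; have D0 : (0 < D)%N by exact: fact_gt0.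
have levelD x : x != 0 -> b (i' x) <= 1 -> exists k : nat, b (i' x) ^+ D = b (i pi) ^+ k.
  move=> x0 hx; have [c [c0 hc]] := power x x0; rewrite hc; apply: hpi => //.
  by rewrite -hc exprn_ile1 // (abs_ge0 bP).
have inj k l : b (i pi) ^+ k = b (i pi) ^+ l -> k = l.
  move=> e; apply: contrapT => /eqP; rewrite neq_ltn => /orP[] h.
    by have := ltr_iXn2l pi0 pi1 l k; rewrite e ltxx h.
  by have := ltr_iXn2l pi0 pi1 k l; rewrite e ltxx h.
(* The uniformizer [pi'] of the extension realizes the least positive exponent k1 such that |pi|^k1
   is the D-th power of an absolute value. Dividing by it lowers the exponent of x by k1, and the
   descent stops at 0. *)
have ex : exists k, `[< (0 < k)%N /\ exists x : K', b (i' x) ^+ D = b (i pi) ^+ k >].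
  exists D; apply/asboolP; split=> //.
  by have [y hy] := ext pi; exists y; rewrite hy.
case: (ex_minnP ex) => k1 /asboolP[k1_gt0 [pi' hpi']] k1_min.
have pi'0 : 0 < b (i' pi').
  rewrite lt_neqAle (abs_ge0 bP) andbT; apply/eqP => e.
  by have := exprn_gt0 k1 pi0; rewrite -hpi' -e expr0n eqn0Ngt D0 ltxx.
exists pi'; split=> //.
  rewrite -(expr_lt1 D0) ?(abs_ge0 bP) // hpi' expr_lt1 //; exact: ltW.
have pi'n0 : pi' != 0 by rewrite -(fmorph_eq0 i') -(abs_gt0 bP).
move=> x x0 hx; have [k hk] := levelD x x0 hx.
elim/ltn_ind: k x x0 hx hk => k IH x x0 hx hk.
have [k0|kpos] := posnP k.
  exists 0%N; rewrite expr0; apply/eqP.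
  rewrite -(pexpr_eq1 D0) ?(abs_ge0 bP) // hk k0 expr0 //.
have lek : (k1 <= k)%N by apply: k1_min; apply/asboolP; split=> //; exists x.
have hdiv : b (i' (x / pi')) ^+ D = b (i pi) ^+ (k - k1).
  rewrite fmorph_div (absM bP) (absV bP) expr_div_n hk hpi'.
  by rewrite -{1}(subnK lek) exprD mulfK // expf_neq0 // gt_eqF.
have [|||l hl] := IH _ _ (x / pi') _ _ hdiv.
- by rewrite -subn_gt0 subKn.
- by rewrite mulf_neq0 ?invr_eq0.
- rewrite -(expr_le1 D0) ?(abs_ge0 bP) // hdiv exprn_ile1 //; exact: ltW.
exists l.+1; rewrite exprSr -hl fmorph_div (absM bP) (absV bP) divfK // gt_eqF //.
Qed.

End DiscreteValuation.

Section Tower.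
Variables (R : realType) (p : nat) (C Qp : fieldType) (Qpbar : closedFieldType).
Variables (a : C -> R) (aQp : Qp -> R) (aQpbar : Qpbar -> R).
Variables (i : {rmorphism rat -> Qp}) (j : {rmorphism Qp -> Qpbar}).
Variable k : {rmorphism Qpbar -> C}.
Hypothesis p_prime : prime p.
Hypothesis Qp_compl : is_completion (@padic_abs R p) aQp i.
Hypothesis j_alg : forall x : Qpbar, algebraicOver j x.
Hypothesis aQpbarP : nonarch_abs aQpbar.
Hypothesis j_isom : forall x : Qp, aQpbar (j x) = aQp x.
Hypothesis C_compl : is_completion aQpbar a k.

Let aP : nonarch_abs a. Proof. exact: completion_abs C_compl. Qed.
Let aQpP : nonarch_abs aQp. Proof. exact: completion_abs Qp_compl. Qed.
Let k_isom x : a (k x) = aQpbar x. Proof. exact: completion_isometry C_compl _. Qed.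
Let i_isom x : aQp (i x) = padic_abs R p x.
Proof. exact: completion_isometry Qp_compl _. Qed.

Let pR_gt1 : 1 < p%:R :> R. Proof. by rewrite ltr1n prime_gt1. Qed.
Let pR_gt0 : 0 < p%:R :> R. Proof. exact: lt_trans pR_gt1. Qed.

Lemma aQp_p : aQp p%:R = p%:R^-1.
Proof.
rewrite -(rmorph_nat i) i_isom /padic_abs pnatr_eq0 eqn0Ngt prime_gt0 //=.
have -> : p%:R = (p%:Z)%:~R :> rat by [].
by rewrite numq_int denq_int absz_nat (logn_prime p p_prime) (_ : `|1%Z|%N = 1%N) // logn1 eqxx sub0r.
Qed.

Lemma abs_nat_p : a p%:R = p%:R^-1.
Proof. by rewrite -(rmorph_nat k) k_isom -(rmorph_nat j) j_isom aQp_p. Qed.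

Let aQp_p_lt1 : aQp p%:R < 1. Proof. by rewrite aQp_p invf_lt1. Qed.

Lemma abs_nat_p_lt1 : a p%:R < 1. Proof. by rewrite abs_nat_p invf_lt1. Qed.

Lemma abs_nat_p_gt0 : 0 < a p%:R. Proof. by rewrite abs_nat_p invr_gt0. Qed.

(** The first estimate transfers congruences from rational numbers to Z_p; the second shows that Q_p
    has the same absolute values as the rational numbers. *)
Lemma aQp_approx x : exists r, aQp (x - i r) < 1 /\ (x != 0 -> aQp x = padic_abs R p r).
Proof.
have [->|x0] := eqVneq x 0.
  by exists 0; rewrite rmorph0 subrr (abs0 aQpP).
have e0 : 0 < Num.min 1 (aQp x) by rewrite lt_min ltr01 (abs_gt0 aQpP).
have [r] := completion_dense Qp_compl x e0; rewrite lt_min => /andP[h1 h2].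
by exists r; split=> // _; rewrite -i_isom (abs_eq_lt aQpP h2).
Qed.

Lemma discrete_Qp : discrete_embedding aQpbar j.
Proof.
exists p%:R; rewrite j_isom aQp_p invr_gt0 invf_lt1 //; split=> // x x0 hx.
rewrite j_isom in hx *; have [r [_ /(_ x0) e]] := aQp_approx x.
have := hx; rewrite e /padic_abs; case: eqP => [r0|_].
  by have := abs_gt0 aQpP x; rewrite x0 e r0 /padic_abs eqxx ltxx.
set z : int := _ - _; case: z => m h.
  exists 0%N; rewrite expr0; apply/eqP; rewrite eq_le h /=.
  by rewrite -exprnP exprn_ege1 // ltW.
by exists m.+1; rewrite NegzE -exprnN -exprVn.
Qed.

Lemma discrete_finite (s : seq Qpbar) :
  exists (K : fieldType) (l : {rmorphism K -> Qpbar}),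
    [/\ discrete_embedding aQpbar l, forall x, exists y, l y = j x &
        forall x, x \in s -> exists y, l y = x].
Proof.
elim: s => [|x s [K [l [dl jl sl]]]].
  by exists Qp, j; split=> // [|x]; [exact: discrete_Qp|exists x].
have x_alg : algebraicOver l x.
  have [f f0 fx] := j_alg x; have /choice[g hg] := jl.
  have e : map_poly l (map_poly g f) = map_poly j f.
    have g0 : g 0 = 0 by apply: (fmorph_inj l); rewrite hg !rmorph0.
    by apply/polyP => m; rewrite !coef_map /= coef_map_id0.
  exists (map_poly g f); last by rewrite e.
  by rewrite -(map_poly_eq0 l) e map_poly_eq0.
have [K' [l' [dl' ll' [y hy]]]] := discrete_adjoin aQpbarP dl x_alg.
exists K', l'; split=> // [z|z].
  by have [t <-] := jl z; exact: ll'.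
by rewrite inE => /orP[/eqP->|/sl[t <-]]; [exists y|exact: ll'].
Qed.

(** There is a circularity: [pi] depends on the field generated by the approximations, whose quality
    is measured by powers of [pi]. It is broken by approximating up to min(1, e) |p| beforehand. For
    m least with |pi|^m <= min(1, e), either m = 0, or |pi|^(m-1) > min(1, e); since |p| <= |pi|,
    the error is at most |pi|^m in both cases. *)
Lemma Cp_discrete_approx (s : seq C) (e : R) : 0 < e ->
  exists (K : C -> Prop) pi m, [/\ discrete_subfield a K pi, a pi ^+ m <= e &
    forall x, x \in s -> exists2 y, K y & a (x - y) <= a pi ^+ m].
Proof.
move=> e0; pose e' := Num.min 1 e * a p%:R.
have e'0 : 0 < e' by rewrite mulr_gt0 ?abs_nat_p_gt0 // lt_min ltr01.
have /choice[y hy] : forall x, exists y, a (x - k y) < e'.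
  by move=> x; exact: (completion_dense C_compl x e'0).
have [K [l [[pi [pi0 pi1 hpi]] jl sl]]] := discrete_finite (map y s).
have kl x : a (k (l x)) = aQpbar (l x) by exact: k_isom.
have disc x : aQpbar (l x) < 1 -> aQpbar (l x) <= aQpbar (l pi).
  have [->|x0] := eqVneq x 0; first by rewrite rmorph0 (abs0 aQpbarP) ltW.
  move=> hx; have [m hm] := hpi x x0 (ltW hx).
  move: hx; rewrite hm; case: m {hm} => [|m _]; first by rewrite expr0 ltxx.
  by rewrite exprS ler_piMr ?(ltW pi0) // exprn_ile1 // ltW.
have ex : exists m, aQpbar (l pi) ^+ m <= Num.min 1 e.
  have [||m hm] := @expr_small R (aQpbar (l pi)) (Num.min 1 e).
  - by rewrite (ltW pi0).
  - by rewrite lt_min ltr01.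
  - by exists m; exact: ltW.
case: (ex_minnP ex) => m hm mmin.
exists (fun x => exists y, x = k (l y)), (k (l pi)), m; split.
- split.
  + by exists 1; rewrite !rmorph1.
  + by move=> _ _ [x ->] [z ->]; exists (x - z); rewrite !rmorphB.
  + by move=> _ _ [x ->] [z ->]; exists (x * z); rewrite !rmorphM.
  + by move=> _ [x ->]; exists x^-1; rewrite !fmorphV.
  + by exists pi.
  + by rewrite kl.
  + by rewrite kl.
  + by move=> _ [x ->]; rewrite !kl; exact: disc.
- by rewrite kl; apply: le_trans hm _; rewrite ge_min lexx orbT.
move=> x xs; have [t ht] := sl (y x) (map_f y xs).
exists (k (y x)); first by exists t; rewrite ht.
apply: le_trans (ltW (hy x)) _; rewrite kl.
have hp : a p%:R <= aQpbar (l pi).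
  have [t' ht'] := jl p%:R.
  have e1 : a p%:R = aQpbar (l t').
    by rewrite ht' -(rmorph_nat k) k_isom rmorph_nat.
  by rewrite e1; apply: disc; rewrite -e1; exact: abs_nat_p_lt1.
case: m hm mmin => [|m] hm mmin.
  rewrite expr0 /e' mulr_ile1 ?(abs_ge0 aP) ?(ltW abs_nat_p_lt1) ?ge_min ?lexx //.
  by rewrite le_min ler01 ltW.
rewrite exprSr /e'; apply: ler_pM => //.
- by rewrite le_min ler01 ltW.
- exact: (abs_ge0 aP).
- have := contra (mmin m); rewrite -ltnNge ltnSn -ltNge => /(_ isT); exact: ltW.
Qed.

Let sQp := abs_small_ideal aQpP p_prime aQp_p_lt1.
Let sC := abs_small_ideal aP p_prime abs_nat_p_lt1.

Lemma frob_fixed_nat n : aQp (n%:R ^+ p - n%:R) < 1.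
Proof.
elim: n => [|n IH]; first by rewrite expr0n eqn0Ngt prime_gt0 //= subrr (abs0 aQpP).
rewrite -natr1; apply: (sid_trans sQp) (sid_frobD sQp (sid_natr sQp n) (sid_1 sQp)) _.
by rewrite expr1n opprD addrACA subrr addr0.
Qed.

Lemma frob_fixed_int z : aQp (z%:~R ^+ p - z%:~R) < 1.
Proof.
case: z => n; first exact: frob_fixed_nat.
rewrite NegzE mulrNz; set x := _%:~R.
have hx : aQp (x ^+ p - x) < 1 by exact: frob_fixed_nat.
have x1 : aQp x <= 1 by exact: (abs_natr_le1 aQpP).
(* Additivity of Frobenius on x + (- x) = 0 shows that (- x)^p is congruent to - x^p whatever the
   parity of p. *)
have := sid_frobD sQp x1 (sid_N sQp x1).
rewrite subrr expr0n eqn0Ngt prime_gt0 // sub0r opprD => h.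
apply: (sid_trans sQp) (_ : aQp ((- x) ^+ p - - x ^+ p) < 1) _.
  by have := sid_IN sQp h; rewrite opprD !opprK addrC.
by have := sid_IN sQp hx; rewrite opprB opprK addrC.
Qed.

Lemma frob_fixed_Zp x : aQp x <= 1 -> aQp (x ^+ p - x) < 1.
Proof.
move=> hx; have [r [hr er]] := aQp_approx x.
have r1 : aQp (i r) <= 1 by exact: (sid_congrS sQp hr hx).
apply: (sid_trans sQp) (sid_congrX sQp _ hx hr) _.
apply: (sid_trans sQp) (sid_sym sQp hr); move: r1 {hr er}.
have -> : i r = (numq r)%:~R / (denq r)%:~R.
  by rewrite -{1}(divq_num_den r) fmorph_div !rmorph_int.
set m := numq r; set d := denq r => md1.
(* If |d| < 1, then |m| < 1 because m / d is integral, and a Bezout relation between m and d would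
   give |1| < 1. *)
have d1 : aQp d%:~R = 1.
  apply: contrapT => /eqP ne.
  have dle : aQp d%:~R <= 1.
    by rewrite -[d]gez0_abs ?denq_ge0 // (abs_natr_le1 aQpP).
  have dlt : aQp d%:~R < 1 by rewrite lt_neqAle ne.
  have mlt : aQp m%:~R < 1.
    have d0 : 0 < aQp d%:~R.
      rewrite (abs_gt0 aQpP) -(rmorph_int i) fmorph_eq0 intr_eq0; exact: denq_neq0.
    apply: le_lt_trans dlt; move: md1.
    by rewrite (absM aQpP) (absV aQpP) ler_pdivrMr // mul1r.
  have /coprimezP[[u v] /= uv] : coprimez m d by exact: coprime_num_den.
  have := abs1 aQpP; rewrite -(rmorph1 (intmul (1 : Qp))) -uv rmorphD !rmorphM /=.
  have h w z : aQp z%:~R < 1 -> aQp (w%:~R * z%:~R) < 1.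
    rewrite (absM aQpP) => hz; apply: le_lt_trans hz; apply: ler_piMl.
      exact: (abs_ge0 aQpP).
    by case: w => n; rewrite ?NegzE ?mulrNz ?(absN aQpP); exact: (abs_natr_le1 aQpP).
  move=> e; have := absD_lt aQpP (h u _ mlt) (h v _ dlt).
  by rewrite e ltxx.
have d0 : d%:~R != 0 :> Qp by rewrite -(abs_eq0 aQpP) d1 oner_eq0.
have -> : (m%:~R / d%:~R) ^+ p - m%:~R / d%:~R =
    ((m%:~R ^+ p - m%:~R) * d%:~R - m%:~R * (d%:~R ^+ p - d%:~R)) / d%:~R ^+ p.+1 :> Qp.
  rewrite expr_div_n exprS; field.
  by rewrite expf_neq0 // d0.
have m1 : aQp m%:~R <= 1.
  by move: md1; rewrite (absM aQpP) (absV aQpP) d1 invr1 mulr1.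
rewrite (absM aQpP) (absV aQpP) (absX aQpP) d1 expr1n invr1 mulr1.
apply: (absB_lt aQpP); rewrite (absM aQpP) ?d1 ?mulr1; first exact: frob_fixed_int.
by apply: le_lt_trans (frob_fixed_int d); apply: ler_piMl => //; exact: (abs_ge0 aQpP).
Qed.

End Tower.

(** * The residue field and algebraic closedness of C_p *)

Section SmallRoots.
Variables (R : realType) (C : fieldType) (a : C -> R).
Hypothesis aP : nonarch_abs a.

(** The reduction of g has more distinct roots than its degree allows, hence is zero. Roots are
    divided out one at a time: |y - x| = 1 passes smallness from g(y) - g(x) to the quotient at
    y. *)
Lemma coef_lt1_of_roots (s : seq C) (g : {poly C}) :
  (forall x, x \in s -> a x <= 1) -> pairwise (fun x y => a (x - y) == 1) s ->
  (size g <= size s)%N -> (forall x, x \in s -> a g.[x] < 1) ->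
  forall i, a g`_i < 1.
Proof.
elim: s g => [|x s IH] g hs /=.
  by move=> _; rewrite leqn0 size_poly_eq0 => /eqP-> _ i; rewrite coef0 (abs0 aP).
move=> /andP[/allP xs ss] sz hg.
have /factor_theorem[q hq] : root (g - g.[x]%:P) x.
  by rewrite rootE hornerD hornerN hornerC subrr.
have eg : g = q * ('X - x%:P) + g.[x]%:P by rewrite -hq subrK.
have gx : a g.[x] < 1 by apply: hg; rewrite mem_head.
have szq : (size q <= size s)%N.
  have [->|q0] := eqVneq q 0; first by rewrite size_poly0.
  have := size_Mmonic q0 (monicXsubC x); rewrite size_XsubC addn2 /= => e.
  rewrite -ltnS -e -hq; apply: leq_trans (size_polyD _ _) _.
  by rewrite geq_max sz size_polyN (leq_trans (size_polyC_leq1 _)).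
have x1 : a x <= 1 by apply: hs; rewrite mem_head.
have hq1 : forall i, a q`_i < 1.
  apply: IH => // y ys; first by apply: hs; rewrite inE ys orbT.
  have : a (g.[y] - g.[x]) < 1.
    by apply: (absB_lt aP) => //; apply: hg; rewrite inE ys orbT.
  rewrite {1}eg hornerD hornerM hornerXsubC hornerC addrK (absM aP).
  by rewrite (abs_distC aP y) (eqP (xs y ys)) mulr1.
move=> i; rewrite eg mulrBr coefD coefB coefMX coefMC coefC.
apply: (absD_lt aP); last by case: eqP => _ //; rewrite (abs0 aP).
apply: (absB_lt aP); first by case: eqP => _ //; rewrite (abs0 aP).
by rewrite (absM aP) mulrC; apply: le_lt_trans (hq1 i); apply: ler_piMl => //; exact: abs_ge0.
Qed.

Lemma poly_normalize (g : {poly C}) : g != 0 ->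
  exists c, [/\ c != 0, forall i, a (c *: g)`_i <= 1 & exists i, a (c *: g)`_i = 1].
Proof.
move=> g0; have sz : (0 < size g)%N by rewrite size_poly_gt0.
case: (arg_maxP (fun i : 'I_(size g) => a g`_i) (erefl : xpredT (Ordinal sz))) => i _ hi.
have gi i' : a g`_i' <= a g`_i.
  have [h|h] := ltnP i' (size g); first exact: (hi (Ordinal h)).
  by rewrite nth_default // (abs0 aP); exact: abs_ge0.
have gi0 : g`_i != 0.
  rewrite -(abs_gt0 aP); apply: lt_le_trans (gi (size g).-1).
  by rewrite (abs_gt0 aP) -/(lead_coef g) lead_coef_eq0.
exists (g`_i)^-1; split; first by rewrite invr_eq0.
  by move=> m; rewrite coefZ (absM aP) (absV aP) mulrC ler_pdivrMr ?mul1r // (abs_gt0 aP).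
by exists i; rewrite coefZ mulVf // (abs1 aP).
Qed.

End SmallRoots.

Section ResidueAlg.
Variables (R : realType) (p : nat) (C Qp : fieldType) (Qpbar : closedFieldType).
Variables (a : C -> R) (aQp : Qp -> R) (aQpbar : Qpbar -> R).
Variables (i : {rmorphism rat -> Qp}) (j : {rmorphism Qp -> Qpbar}).
Variable k : {rmorphism Qpbar -> C}.
Hypothesis p_prime : prime p.
Hypothesis Qp_compl : is_completion (@padic_abs R p) aQp i.
Hypothesis j_alg : forall x : Qpbar, algebraicOver j x.
Hypothesis aQpbarP : nonarch_abs aQpbar.
Hypothesis j_isom : forall x : Qp, aQpbar (j x) = aQp x.
Hypothesis C_compl : is_completion aQpbar a k.

Let aP : nonarch_abs a. Proof. exact: completion_abs C_compl. Qed.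
Let aQpP : nonarch_abs aQp. Proof. exact: completion_abs Qp_compl. Qed.
Let k_isom x : a (k x) = aQpbar x. Proof. exact: completion_isometry C_compl _. Qed.
Let b_lt1 : aQpbar p%:R < 1.
Proof.
rewrite -k_isom rmorph_nat.
exact: (abs_nat_p_lt1 p_prime Qp_compl j_isom C_compl).
Qed.
Let sB := abs_small_ideal aQpbarP p_prime b_lt1.

(* The y^(p^m) are roots, modulo small elements, of a single normalized
   polynomial with coefficients in Q_p; hence two of them are congruent. *)
Lemma residue_alg_Qpbar y : aQpbar y <= 1 ->
  exists2 m, (0 < m)%N & aQpbar (y ^+ (p ^ m) - y) < 1.
Proof.
move=> y1; have [f f0 fy] := j_alg y.
have [c [c0 hle [i0 hi0]]] := poly_normalize aQpP f0; set g := c *: f in hle hi0.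
have gy : (map_poly j g).[y] = 0.
  by rewrite /g map_polyZ hornerZ (rootP fy) mulr0.
have fixed m t : aQpbar ((j g`_t) ^+ (p ^ m) - j g`_t) < 1.
  rewrite -rmorphXn -rmorphB j_isom; have sQp := abs_small_ideal aQpP p_prime.
  have aQp_lt1 : aQp p%:R < 1 by rewrite -j_isom rmorph_nat.
  elim: m => [|m IH]; first by rewrite expr1 subrr (abs0 aQpP).
  rewrite expnS exprM; apply: (sid_trans (sQp aQp_lt1)) IH.
  apply: (sid_congrX (sQp aQp_lt1)).
    by rewrite (absX aQpP) exprn_ile1 // (abs_ge0 aQpP).
  exact: (frob_fixed_Zp p_prime Qp_compl (hle t)).
pose ys m := y ^+ (p ^ m).
have ys1 m : aQpbar (ys m) <= 1 by apply: (sid_X sB).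
(* The coefficients are in Z_p, hence fixed by Frobenius modulo small elements, so the value at
   y^(p^m) is congruent to the p^m-th power of the value at y, which is 0. *)
have small m : aQpbar (map_poly j g).[ys m] < 1.
  pose u (t : 'I_(size (map_poly j g))) := (map_poly j g)`_t * y ^+ t.
  have u1 t : aQpbar (u t) <= 1.
    by apply: (sid_M sB); [rewrite coef_map /= j_isom|exact: (sid_X sB)].
  have := sid_frob_sum sB m (index_enum _) u1.
  rewrite -horner_coef gy expr0n expn_eq0 eqn0Ngt prime_gt0 //= sub0r => h1.
  rewrite horner_coef -[X in aQpbar X]subr0.
  apply: (sid_trans sB) (_ : aQpbar (\sum_t u t ^+ (p ^ m) - 0) < 1).
    apply: (sid_congr_sum sB) => t; rewrite /u exprMn coef_map /=.
    rewrite /ys -!exprM [(p ^ m * t)%N]mulnC -mulrBl mulrC; apply: (sid_IM sB).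
      exact: (sid_X sB).
    by rewrite (abs_distC aQpbarP) fixed.
  by rewrite subr0 -(absN aQpbarP).
have [l [m [lm hlm]]] : exists l m, (l < m)%N /\ aQpbar (ys m - ys l) < 1.
  apply: contrapT => no.
  suff /(_ i0) : forall t, aQpbar (map_poly j g)`_t < 1.
    by rewrite coef_map j_isom hi0 ltxx.
  apply: (coef_lt1_of_roots aQpbarP (s := [seq ys m | m <- iota 0 (size g)])).
  - by move=> x /mapP[m _ ->].
  - rewrite pairwise_map; apply: (@sub_pairwise _ ltn); last first.
      by rewrite -(sorted_pairwise ltn_trans) iota_ltn_sorted.
    move=> l m /= lm; rewrite eq_le (sid_B sB) //= leNgt.
    by apply/negP => h; apply: no; exists l, m; rewrite (abs_distC aQpbarP).
  - by rewrite size_map size_iota size_map_poly.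
  - by move=> x /mapP[m _ ->].
exists (m - l)%N; first by rewrite subn_gt0.
set z := y ^+ (p ^ (m - l)).
have z1 : aQpbar z <= 1 by exact: (sid_X sB).
have e : ys m = z ^+ (p ^ l) by rewrite /z -exprM -expnD subnK // ltnW.
have h0 : (0 < p ^ l)%N by rewrite expn_gt0 prime_gt0.
rewrite -(expr_lt1 h0) ?(abs_ge0 aQpbarP) // -(absX aQpbarP).
(* Raising to the power p^l is injective on residues: (z - y)^(p^l) is congruent to [ys m - ys l],
   which is small. *)
have := sid_frobD_exp sB l (sid_B sB z1 y1) y1; rewrite subrK -e => h.
rewrite -[X in aQpbar X](addrK (ys l)); apply: (sid_trans sB) hlm.
by have := sid_sym sB h.
Qed.

Lemma residue_alg_Cp x : a x <= 1 -> exists2 m, (0 < m)%N & a (x ^+ (p ^ m) - x) < 1.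
Proof.
move=> x1; have sC := abs_small_ideal aP p_prime.
have a_lt1 : a p%:R < 1 by exact: (abs_nat_p_lt1 p_prime Qp_compl j_isom C_compl).
have [y hy] := completion_dense C_compl x (ltr01 : 0 < 1 :> R).
have y1 : aQpbar y <= 1.
  by rewrite -k_isom; exact: (sid_congrS (sC a_lt1) hy).
have [m m0 hm] := residue_alg_Qpbar y1; exists m => //.
apply: (sid_trans (sC a_lt1)) (sid_congrX (sC a_lt1) _ x1 hy) _.
apply: (sid_trans (sC a_lt1)) (sid_sym (sC a_lt1) hy).
by rewrite -rmorphXn -rmorphB k_isom.
Qed.

End ResidueAlg.

(** * Roots in the completion of an algebraically closed field *)

Section Closed.
Variables (R : realType) (L : closedFieldType) (C : fieldType).
Variables (b : L -> R) (a : C -> R) (k : {rmorphism L -> C}).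
Hypothesis C_compl : is_completion b a k.

Let aP : nonarch_abs a. Proof. exact: completion_abs C_compl. Qed.

Lemma monic_root_bound (g : {poly C}) (B : R) x : g \is monic -> 1 <= B ->
  (forall i, a g`_i <= B) -> root g x -> a x <= B.
Proof.
move=> gm B1 gB /rootP gx; rewrite leNgt; apply/negP => hx.
have sz : size g = (size g).-1.+1 by rewrite prednK // size_poly_gt0 monic_neq0.
set d := (size g).-1 in sz.
have x0 : 0 < a x by apply: lt_trans hx; exact: lt_le_trans B1.
have x1 : 1 <= a x by apply: ltW; exact: le_lt_trans hx.
have gd : g`_d = 1 by apply/eqP; rewrite -monicE in gm *; exact: gm.
move: gx; rewrite horner_coef sz big_ord_recr /= gd mul1r => /eqP.
rewrite addr_eq0 => /eqP e.
have : a (x ^+ d) < a (x ^+ d).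
  rewrite -{1}(absN aP) -e; case: d {sz gd} e => [|d] e.
    move: e; rewrite big_ord0 expr0 => /eqP; rewrite eq_sym oppr_eq0 oner_eq0 //.
  apply: (abs_sum_lt aP); first by rewrite (absX aP) exprn_gt0.
  move=> t _; rewrite (absM aP) !(absX aP) exprS.
  apply: (@le_lt_trans _ _ (B * a x ^+ d)).
    apply: ler_pM => //; try exact: abs_ge0.
      by rewrite exprn_ge0 // abs_ge0.
    by apply: ler_weXn2l => //; rewrite -ltnS.
  by rewrite ltr_pM2r // exprn_gt0.
by rewrite ltxx.
Qed.

Lemma prod_le_exists (I : Type) (s : seq I) (F : I -> R) (r : R) :
  0 <= r -> s <> [::] -> \prod_(t <- s) F t <= r ^+ size s ->
  exists2 t, List.In t s & F t <= r.
Proof.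
move=> r0; elim: s => // t s IH _; rewrite big_cons /= exprS => h.
have [ht|ht] := leP (F t) r; first by exists t => //; left.
have [s0|s0] := pselect (s = [::]).
  by move: h ht; rewrite s0 big_nil expr0 !mulr1 leNgt => /negPf->.
have [hs|hs] := leP (\prod_(j <- s) F j) (r ^+ size s).
  by have [t' t's ht'] := IH s0 hs; exists t' => //; right.
have : r * r ^+ size s < F t * \prod_(j <- s) F j.
  apply: ltr_pM => //; exact: exprn_ge0.
by move=> /(le_lt_trans h); rewrite ltxx.
Qed.

Variables (f : {poly C}) (B : R).
Hypotheses (f_monic : f \is monic) (sz_f : (1 < size f)%N) (B1 : 1 <= B).
Hypothesis fB : forall i, a f`_i <= B.
Let d := (size f).-1.
Let szd : size f = d.+1. Proof. by rewrite prednK // ltnW. Qed.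
Let d_gt0 : (0 < d)%N. Proof. by rewrite -ltnS -szd. Qed.
Let B0 : 0 < B. Proof. exact: lt_le_trans B1. Qed.
Let a_ge0 x : 0 <= a x. Proof. exact: abs_ge0. Qed.
Hint Resolve a_ge0 : core.

(** Replace f by a nearby monic g over [L], which splits. The distances from x to its d roots have
    product |g(x)| <= r^d, so some root is within r of x; at this root f equals f - g, which is
    tiny. *)
Lemma closed_step x r s : 0 < s <= r -> a x <= B -> a f.[x] <= r ^+ d ->
  exists y, [/\ a y <= B, a (x - y) <= r & a f.[y] <= s ^+ d].
Proof.
move=> /andP[s0 sr] xB hx.
have r0 : 0 < r by exact: lt_le_trans sr.
(* The second bound gives |f - g| <= s^d on the disk of radius [B]; the bound 1 keeps the
   coefficients of g below [B]. *)
pose e := Num.min 1 (s ^+ d / B ^+ d).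
have e0 : 0 < e by rewrite lt_min ltr01 divr_gt0 // exprn_gt0.
have /choice[c hc] : forall t, exists c, a (f`_t - k c) < e.
  by move=> t; exact: (completion_dense C_compl f`_t e0).
pose g : {poly L} := 'X^d + \poly_(t < d) c t.
have szp : (size (\poly_(t < d) c t) < size ('X^d : {poly L}))%N.
  by rewrite size_polyXn ltnS size_poly.
have szg : size g = d.+1 by rewrite /g size_polyDl // size_polyXn.
have gm : g \is monic by rewrite monicE lead_coefDl // lead_coefXn.
have fd : f`_d = 1 by exact: (monicP f_monic).
have gfi t : a (f`_t - (map_poly k g)`_t) < e.
  rewrite coef_map /= coefD coefXn coef_poly; case: ltngtP => [h|h|->].
  - by rewrite add0r hc.
  - by rewrite nth_default ?szd // addr0 rmorph0 subr0 (abs0 aP).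
  - by rewrite addr0 rmorph1 fd subrr (abs0 aP).
have gB t : a (map_poly k g)`_t <= B.
  rewrite -[_`_t](subKr f`_t); apply: (absB_le aP) => //.
  by apply: le_trans (ltW (gfi t)) _; rewrite ge_min B1.
have close y : a y <= B -> a (f.[y] - (map_poly k g).[y]) <= s ^+ d.
  move=> yB; rewrite -hornerN -hornerD (@horner_coef_wide _ d.+1); last first.
    rewrite (leq_trans (size_polyD _ _)) // geq_max szd leqnn size_polyN.
    by rewrite size_map_poly szg leqnn.
  apply: (abs_sum_le aP) => [|t _]; first by rewrite exprn_ge0 // ltW.
  rewrite (absM aP) (absX aP) coefB.
  apply: (@le_trans _ _ (e * B ^+ d)).
    apply: ler_pM => //; first by rewrite exprn_ge0.
      exact: ltW.
    apply: (@le_trans _ _ (B ^+ t)); first by rewrite lerXn2r // nnegrE // ltW.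
    by apply: ler_weXn2l => //; rewrite -ltnS.
  rewrite -ler_pdivlMr ?exprn_gt0 // /e ge_min lexx orbT //.
have [rs hrs] := closed_field_poly_normal g.
move: hrs; rewrite (monicP gm) scale1r => hrs.
have mg : map_poly k g = \prod_(z <- rs) ('X - (k z)%:P).
  rewrite hrs rmorph_prod; apply: eq_bigr => z _.
  by rewrite rmorphB /= map_polyX map_polyC.
have szrs : size rs = d.
  by have := szg; rewrite hrs size_prod_XsubC => -[].
have gx : a (map_poly k g).[x] <= r ^+ size rs.
  rewrite -[_.[x]](subKr f.[x]); apply: (absB_le aP); first by rewrite szrs.
  apply: le_trans (close x xB) _; rewrite szrs.
  by rewrite lerXn2r // nnegrE ltW.
move: gx; rewrite mg horner_prod (abs_prod aP).
have rs0 : rs <> [::] by move=> e'; move: szrs d_gt0; rewrite e' => <-.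
move=> /(prod_le_exists (ltW r0) rs0)[z zrs]; rewrite hornerXsubC => hz.
have gz : root (map_poly k g) (k z).
  rewrite fmorph_root hrs root_prod_XsubC.
  by elim: rs zrs {hrs mg szrs rs0} => //= t s' IH [->|/IH]; rewrite inE ?eqxx // => ->; rewrite orbT.
have zB : a (k z) <= B by apply: monic_root_bound gz => //; rewrite monic_map.
exists (k z); split=> //.
by rewrite -[f.[_]]subr0 -(rootP gz) close.
Qed.

Lemma horner_lipschitz x y : a x <= B -> a y <= B ->
  a (f.[x] - f.[y]) <= a (x - y) * B ^+ d.+1.
Proof.
move=> xB yB; rewrite !horner_coef -sumrB; apply: (abs_sum_le aP) => [|t _].
  by rewrite mulr_ge0 // exprn_ge0 // ltW.
have td : (t <= d)%N by rewrite -ltnS -szd.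
rewrite -mulrBr subrXX !(absM aP) mulrCA; apply: ler_wpM2l => //.
rewrite exprS; apply: ler_pM => //; apply: (abs_sum_le aP) => [|m _].
  by rewrite exprn_ge0 // ltW.
rewrite (absM aP) !(absX aP).
apply: (@le_trans _ _ (B ^+ (t.-1 - m) * B ^+ m)).
  by apply: ler_pM; rewrite ?exprn_ge0 // lerXn2r // nnegrE // ltW.
rewrite -exprD; apply: ler_weXn2l => //.
have := ltn_ord m; have := ltn_ord t; move: td; lia.
Qed.

Lemma monic_has_root : exists x, root f x.
Proof.
(* Starting at radius [B] makes 0 a valid first approximation: |f(0)| <= B <= B^d, as d > 0. *)
pose dl (n : nat) := B * (2^-1) ^+ n.
have half : 0 <= (2^-1 : R) < 1 by rewrite invr_ge0 ler0n invf_lt1 ?ltr1n ?ltr0n.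
have dl_gt0 n : 0 < dl n by rewrite mulr_gt0 // exprn_gt0 // invr_gt0.
have dlS n : dl n.+1 <= dl n.
  rewrite /dl exprS mulrCA ler_piMl ?(ltW (dl_gt0 n)) //.
  by case/andP: half => _ /ltW.
have dlW m n : (m <= n)%N -> dl n <= dl m.
  by move=> /subnK <-; elim: (n - m)%N => // t IH; exact: le_trans (dlS _) IH.
have dl_small e : 0 < e -> exists n, dl n < e.
  move=> e0; have [|n hn] := @expr_small R 2^-1 (e / B) half; first exact: divr_gt0.
  by exists n; rewrite /dl mulrC -ltr_pdivlMr.
have /choice[next hnext] : forall nx : nat * C, exists y,
    a nx.2 <= B -> a f.[nx.2] <= dl nx.1 ^+ d ->
    [/\ a y <= B, a (nx.2 - y) <= dl nx.1 & a f.[y] <= dl nx.1.+1 ^+ d].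
  move=> [n x] /=; have [h|h] := pselect (a x <= B /\ a f.[x] <= dl n ^+ d).
    have [||| y hy] := @closed_step x (dl n) (dl n.+1); try by case: h.
      by rewrite dl_gt0 dlS.
    by exists y.
  by exists 0 => h1 h2; case: h.
pose u := fix u n := if n is m.+1 then next (m, u m) else 0.
have hu n : a (u n) <= B /\ a f.[u n] <= dl n ^+ d.
  elim: n => [|n [IH1 IH2]]; last by have [] := hnext (n, u n) IH1 IH2.
  rewrite /= (abs0 aP) ltW // /dl expr0 mulr1 horner_coef0; split=> //.
  by apply: le_trans (fB 0) _; rewrite -[leLHS]expr1 ler_weXn2l.
have hS n : a (u n - u n.+1) <= dl n.
  by have [h1 h2] := hu n; have [] := hnext (n, u n) h1 h2.
have hmn m n : (m <= n)%N -> a (u m - u n) <= dl m.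
  move=> /subnK <-; elim: (n - m)%N => [|t IH]; first by rewrite subrr (abs0 aP) ltW.
  rewrite -(subrKA (u (t + m)%N)); apply: (absD_le aP) => //.
  by apply: le_trans (hS _) _; apply: dlW; rewrite leq_addl.
have [|x hx] := @completion_complete _ _ _ _ _ _ C_compl u.
  move=> e /dl_small[n hn]; exists n => m m' nm nm'.
  rewrite -(subrKA (u n)); apply: (absD_lt aP); last exact: le_lt_trans (hmn _ _ nm') hn.
  by rewrite (abs_distC aP); exact: le_lt_trans (hmn _ _ nm) hn.
have xB : a x <= B.
  have [n0 hn0] := hx _ B0.
  rewrite -[x](subKr (u n0)); apply: (absB_le aP); first by have [] := hu n0.
  exact/ltW/hn0.
exists x; apply/rootP/eqP; rewrite -(abs_eq0 aP) eq_le a_ge0 andbT leNgt.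
apply/negP => fx0; set e := a f.[x] in fx0.
have BD : 0 < B ^+ d.+1 by exact: exprn_gt0.
have [n0 hn0] := hx (e / B ^+ d.+1) (divr_gt0 fx0 BD).
have e1 : 0 < Num.min 1 e by rewrite lt_min ltr01.
have [n1 hn1] := dl_small _ e1.
pose n := maxn n0 n1; have [unB fun_] := hu n.
have h1 : a (f.[x] - f.[u n]) < e.
  apply: le_lt_trans (horner_lipschitz xB unB) _.
  by rewrite -ltr_pdivlMr // (abs_distC aP) hn0 // leq_maxl.
have h2 : a f.[u n] < e.
  have : dl n < Num.min 1 e by apply: le_lt_trans hn1; rewrite dlW // leq_maxr.
  rewrite lt_min => /andP[dn1 dne]; apply: le_lt_trans fun_ _.
  apply: le_lt_trans dne; rewrite -[leRHS]expr1; apply: ler_wiXn2l => //; exact: ltW.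
by have := absD_lt aP h1 h2; rewrite subrK ltxx.
Qed.

End Closed.

Lemma completion_root (R : realType) (L : closedFieldType) (C : fieldType)
    (b : L -> R) (a : C -> R) (k : {rmorphism L -> C}) (f : {poly C}) :
  is_completion b a k -> (1 < size f)%N -> exists x, root f x.
Proof.
move=> hC sf; have aP := completion_abs hC.
have f0 : f != 0 by rewrite -size_poly_gt0 ltnW.
have l0 : lead_coef f != 0 by rewrite lead_coef_eq0.
have l0' : (lead_coef f)^-1 != 0 by rewrite invr_eq0.
pose g := (lead_coef f)^-1 *: f.
have gm : g \is monic by rewrite monicE lead_coefZ mulVf.
pose B := 1 + \sum_(i < size g) a g`_i.
have [|||x hx] := @monic_has_root R L C b a k hC g B gm.
- by rewrite size_scale.
- by rewrite lerDl sumr_ge0 // => i _; exact: (abs_ge0 aP).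
- move=> i; have [h|h] := ltnP i (size g); last first.
    rewrite nth_default // (abs0 aP) addr_ge0 // sumr_ge0 // => t _.
    exact: (abs_ge0 aP).
  rewrite /B (bigD1 (Ordinal h)) //= addrCA lerDl addr_ge0 // sumr_ge0 // => t _.
  exact: (abs_ge0 aP).
by exists x; move: hx; rewrite /g rootZ.
Qed.

(** * Fibers of finite maps *)

Record ideal_like (B : comNzRingType) (J : B -> Prop) : Prop := {
  ideal_0 : J 0;
  ideal_D : forall x y, J x -> J y -> J (x + y);
  ideal_M : forall x y, J y -> J (x * y)
}.

Section Ideals.
Variables (C : fieldType) (n : nat).
Implicit Types (b f g x : {mpoly C[n]}) (J I : {mpoly C[n]} -> Prop).
Implicit Types (T : n.-tuple {mpoly C[n]}).

Lemma ideal_sum J (I : Type) (r : seq I) (P : pred I) (F : I -> {mpoly C[n]}) :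
  ideal_like J -> (forall i, P i -> J (F i)) -> J (\sum_(i <- r | P i) F i).
Proof.
by move=> HJ hF; elim/big_ind: _ => //; [exact: ideal_0 HJ|exact: ideal_D HJ].
Qed.

Lemma ideal_N J x : ideal_like J -> J x -> J (- x).
Proof. by move=> HJ h; rewrite -mulN1r; exact: ideal_M. Qed.

Lemma ideal_Z J c x : ideal_like J -> J x -> J (c *: x).
Proof. by move=> HJ h; rewrite -mul_mpolyC; exact: ideal_M. Qed.

Lemma ideal_comp_eval J T (w : 'I_n -> C) b : ideal_like J ->
  (forall i, J (tnth T i - (w i)%:MP)) -> J (b \mPo T - (b.@[w])%:MP).
Proof.
move=> HJ hT; rewrite comp_mpolyE mevalE raddf_sum /= -sumrB.
apply: ideal_sum => // m _; rewrite -mul_mpolyC mpolyCM -mulrBr.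
apply: ideal_M => //; rewrite rmorph_prod /=.
elim/big_rec2: _ => [|i x y _ h]; first by rewrite subrr; exact: ideal_0.
rewrite -(subrKA (tnth T i ^+ m i * x)) -mulrBr; apply: ideal_D => //.
  exact: ideal_M.
rewrite -mulrBl mulrC; apply: ideal_M => //.
by rewrite rmorphXn subrXX mulrC; exact: ideal_M.
Qed.

Definition adjoin_gen J x b := exists y g, J y /\ b = y + g * x.

Lemma adjoin_ideal J x : ideal_like J -> ideal_like (adjoin_gen J x).
Proof.
move=> HJ; split.
- by exists 0, 0; split; [exact: ideal_0|rewrite mul0r addr0].
- move=> _ _ [y [g [Jy ->]]] [y' [g' [Jy' ->]]]; exists (y + y'), (g + g').
  by split; [exact: ideal_D|rewrite mulrDl addrACA].
- move=> z _ [y [g [Jy ->]]]; exists (z * y), (z * g).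
  by split; [exact: ideal_M|rewrite mulrDr mulrA].
Qed.

Hypothesis closedC : forall f : {poly C}, (1 < size f)%N -> exists r : C, root f r.

Let ev (P : {poly C}) x := (map_poly (@mpolyC n C) P).[x].

(** P(x) is up to a nonzero constant a product of factors x - r; were all of them invertible modulo
    J, then J would contain 1. *)
Lemma adjoin_root J x (P : {poly C}) : ideal_like J -> ~ J 1 -> P != 0 -> J (ev P x) ->
  exists c : C, ~ adjoin_gen J (x - c%:MP) 1.
Proof.
move=> HJ J1; have [m sP] := ubnP (size P).
elim: m P sP => // m IH P sP P0 JP.
have [sz|sz] := leqP (size P) 1.
  case: J1; have [c c0 eP] : exists2 c, c != 0 & P = c%:P.
    by exists P`_0; [rewrite -polyC_eq0|]; rewrite -size1_polyC.
  have -> : 1 = c^-1 *: ev P x.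
    by rewrite /ev eP map_polyC hornerC -mul_mpolyC -mpolyCM mulVf.
  exact: ideal_Z.
have [r Pr] := closedC sz; have /factor_theorem[q eP] := Pr.
have q0 : q != 0 by apply: contraNneq P0 => e; rewrite eP e mul0r.
have eJ : ev P x = ev q x * (x - r%:MP).
  by rewrite /ev eP rmorphM rmorphB /= map_polyX map_polyC hornerM hornerXsubC.
have [[y [g [Jy e1]]]|no] := pselect (adjoin_gen J (x - r%:MP) 1); last by exists r.
apply: (IH q) => //.
  by move: sP; rewrite eP size_Mmonic ?monicXsubC // size_XsubC addn2.
rewrite -[ev q x]mulr1 e1 mulrDr; apply: ideal_D => //; first exact: ideal_M.
by rewrite mulrCA -eJ; exact: ideal_M.
Qed.

(** As every element is algebraic modulo J, the coordinates of the zero can be fixed one at a time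
    while the ideal stays proper. Once it contains all ['X_i - (c i)%:MP], each b is congruent to
    its value at c, which must be 0 for b in J. *)
Lemma nullstellensatz J : ideal_like J -> ~ J 1 ->
  (forall x, exists2 P : {poly C}, P != 0 & J (ev P x)) ->
  exists c : 'I_n -> C, forall b, J b -> b.@[c] = 0.
Proof.
move=> HJ J1 hJ.
have [J' [HJ' J'1 JJ' hc]] : exists J', [/\ ideal_like J', ~ J' 1,
    forall b, J b -> J' b & forall i, i \in enum 'I_n -> exists c : C, J' ('X_i - c%:MP)].
  elim: (enum 'I_n) => [|i r [J' [HJ' J'1 JJ' hc]]]; first by exists J; split.
  have [P P0 /JJ' JP] := hJ 'X_i; have [c hc'] := adjoin_root HJ' J'1 P0 JP.
  have sub b : J' b -> adjoin_gen J' ('X_i - c%:MP) b.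
    by exists b, 0; rewrite mul0r addr0.
  exists (adjoin_gen J' ('X_i - c%:MP)); split => //.
  - exact: adjoin_ideal.
  - by move=> b /JJ'/sub.
  move=> l; rewrite inE => /orP[/eqP->|/hc[c' h]]; last by exists c'; exact: sub.
  by exists c, 0, 1; rewrite mul1r add0r; split => //; exact: ideal_0.
have /choice[c hc'] : forall i : 'I_n, exists c : C, J' ('X_i - c%:MP).
  by move=> i; apply: hc; rewrite mem_enum.
exists c => b /JJ' J'b; apply: contrapT => /eqP bc; apply: J'1.
have h : J' ((b.@[c])%:MP).
  rewrite -[_%:MP](subKr b); apply: ideal_D => //; apply: ideal_N => //.
  rewrite -{1}(comp_mpoly_id b); apply: ideal_comp_eval => // i.
  by rewrite tnth_mktuple.
have -> : 1 = (b.@[c])^-1 *: (b.@[c])%:MP :> {mpoly C[n]}.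
  by rewrite -mul_mpolyC -mpolyCM mulVf.
exact: ideal_Z.
Qed.

Section Finite.
Variables (m : nat) (e : 'I_m -> {mpoly C[n]}) (T : n.-tuple {mpoly C[n]}).
Hypothesis spanT : forall b, exists c : 'I_m -> {mpoly C[n]},
  b = \sum_i (c i \mPo T) * e i.

(** Modulo J the entries of [T] are constants, so the [m] elements [e i] span the quotient over [C],
    and the powers of x up to the m-th are linearly dependent. *)
Lemma algebraic_mod J (w : 'I_n -> C) : ideal_like J ->
  (forall i, J (tnth T i - (w i)%:MP)) ->
  forall x, exists2 P : {poly C}, P != 0 & J (ev P x).
Proof.
move=> HJ hT x.
have /choice[c hc] : forall l : 'I_m.+1, exists c : 'I_m -> {mpoly C[n]},
    x ^+ l = \sum_i (c i \mPo T) * e i by move=> l; exact: spanT.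
have [u u0 uA] := linear_dependence (\matrix_(l, i) (c l i).@[w]).
exists (\poly_(l < m.+1) u 0 (inord l)).
  apply: contraNneq u0 => P0; apply/eqP/rowP => l.
  have := congr1 (fun P : {poly C} => P`_l) P0.
  by rewrite coef_poly ltn_ord inord_val mxE coef0.
rewrite /ev (@horner_coef_wide _ m.+1); last first.
  by rewrite (leq_trans (size_poly _ _)) // size_poly.
pose y (l : 'I_m.+1) := \sum_i ((c l i).@[w])%:MP * e i.
have y0 : \sum_l (u 0 l)%:MP * y l = 0.
  transitivity (\sum_i ((u *m \matrix_(l, i) (c l i).@[w]) 0 i)%:MP * e i).
    under eq_bigr => l _ do rewrite mulr_sumr.
    rewrite exchange_big /=; apply: eq_bigr => i _.
    rewrite mxE raddf_sum /= mulr_suml; apply: eq_bigr => l _.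
    by rewrite mxE mulrA mpolyCM.
  by rewrite uA big1 // => i _; rewrite mxE mpolyC0 mul0r.
rewrite -[X in J X]subr0 -[X in _ - X]y0 -sumrB; apply: ideal_sum => // l _.
rewrite coef_map coef_poly ltn_ord inord_val /= -mulrBr; apply: ideal_M => //.
rewrite hc -sumrB; apply: ideal_sum => // i _.
rewrite -mulrBl mulrC; apply: ideal_M => //; exact: ideal_comp_eval.
Qed.

(* If the ideal generated by I and the T_i - w_i is proper, the Nullstellensatz
   gives the point c; otherwise Nakayama's lemma gives D as a determinant. *)
Lemma fiber_point_or_cut I (w : 'I_n -> C) : ideal_like I ->
  (exists c : 'I_n -> C, (forall f, I f -> f.@[c] = 0) /\
     forall i, (tnth T i).@[c] = w i) \/
  (exists D : {mpoly C[n]}, (forall b, I ((D \mPo T) * b)) /\ D.@[w] = 1).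
Proof.
move=> HI.
pose J b := exists f (g : 'I_n -> {mpoly C[n]}), I f /\
  b = f + \sum_i g i * (tnth T i - (w i)%:MP).
have HJ : ideal_like J.
  split.
  - exists 0, (fun=> 0); split; first exact: ideal_0.
    by rewrite big1 ?addr0 // => i _; rewrite mul0r.
  - move=> _ _ [f [g [If ->]]] [f' [g' [If' ->]]].
    exists (f + f'), (fun i => g i + g' i); split; first exact: ideal_D.
    rewrite addrACA; congr (_ + _); rewrite -big_split; apply: eq_bigr => i _.
    by rewrite mulrDl.
  - move=> x _ [f [g [If ->]]]; exists (x * f), (fun i => x * g i).
    split; first exact: ideal_M.
    rewrite mulrDr mulr_sumr; congr (_ + _); apply: eq_bigr => i _.
    by rewrite mulrA.
have JI f : I f -> J f.
  move=> If; exists f, (fun=> 0); split=> //.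
  by rewrite big1 ?addr0 // => i _; rewrite mul0r.
have JT i : J (tnth T i - (w i)%:MP).
  exists 0, (fun l => (l == i)%:R); split; first exact: ideal_0.
  rewrite add0r (bigD1 i) //= eqxx mul1r big1 ?addr0 // => l /negPf ->.
  by rewrite mul0r.
have [J1|J1] := pselect (J 1); last first.
  left; have [c hc] := nullstellensatz HJ J1 (algebraic_mod HJ JT).
  exists c; split=> [f /JI/hc //|i].
  by have := hc _ (JT i); rewrite mevalB mevalC => /eqP; rewrite subr_eq0 => /eqP.
right.
have /choice[f /choice[g hfg]] : forall l, exists f (g : 'I_n -> {mpoly C[n]}), I f /\
    e l = f + \sum_i g i * (tnth T i - (w i)%:MP).
  by move=> l; rewrite -[e l]mulr1; exact: (ideal_M HJ (e l) J1).
have /choice[h hh] : forall li : 'I_m * 'I_n, exists c : 'I_m -> {mpoly C[n]},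
    g li.1 li.2 = \sum_i (c i \mPo T) * e i by move=> li; exact: spanT.
(* Expressing 1 in J gives e = f + c(T) e, with the entries of f in I and those of c vanishing at w.
   So [A = 1%:M - c] satisfies A(T) e = f; the adjugate puts det A(T) times each [e l] in I, and
   A(w) is the identity. *)
pose c : 'M[{mpoly C[n]}]_m := \matrix_(l, l') \sum_i h (l, i) l' * ('X_i - (w i)%:MP).
pose A := 1%:M - c.
have hA l : \sum_l' (A l l' \mPo T) * e l' = f l.
  have -> : f l = e l - \sum_l' (c l l' \mPo T) * e l'.
    have [_ {1}->] := hfg l; apply/eqP; rewrite eq_sym subr_eq addrC; apply/eqP.
    rewrite addrC; congr (_ + _).
    under [RHS]eq_bigr => l' _ do rewrite mxE raddf_sum /= mulr_suml.
    rewrite exchange_big /=; apply: eq_bigr => i _; rewrite (hh (l, i)) mulr_suml.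
    apply: eq_bigr => l' _; rewrite rmorphM /= comp_mpolyB comp_mpolyXU comp_mpolyC.
    by rewrite -tnth_nth mulrAC.
  rewrite -[X in X - _](_ : \sum_l' ((1%:M : 'M_m) l l' \mPo T) * e l' = _).
    rewrite -sumrB; apply: eq_bigr => l' _.
    by rewrite /A !mxE comp_mpolyB mulrBl.
  rewrite (bigD1 l) //= mxE eqxx comp_mpoly1 mul1r big1 ?addr0 // => l' /negPf ll'.
  by rewrite mxE eq_sym ll' comp_mpoly0 mul0r.
exists (\det A); split; last first.
  rewrite -(det_map_mx (meval w)) -(det1 C m); congr (\det _); apply/matrixP => l l'.
  rewrite !mxE raddfB /= rmorph_nat [X in _ - X]raddf_sum /= big1 ?subr0 // => i _.
  by rewrite mevalM mevalB mevalXU mevalC subrr mulr0.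
have hd l : I ((\det A \mPo T) * e l).
  have -> : (\det A \mPo T) * e l = \sum_l1 (\adj A l l1 \mPo T) * f l1.
    under [RHS]eq_bigr => l1 _ do rewrite -hA mulr_sumr.
    rewrite exchange_big /=.
    under [RHS]eq_bigr => l2 _.
      under eq_bigr => l1 _ do rewrite mulrA -rmorphM /=.
      rewrite -mulr_suml -raddf_sum /=.
      have -> : \sum_i \adj A l i * A i l2 = (\adj A *m A) l l2 by rewrite mxE.
      rewrite mul_adj_mx mxE.
      over.
    rewrite (bigD1 l) //= eqxx mulr1n big1 ?addr0 // => l2 /negPf ll2.
    by rewrite eq_sym ll2 mulr0n comp_mpoly0 mul0r.
  apply: ideal_sum => // l1 _; apply: ideal_M => //; exact: (hfg l1).1.
move=> b; have [cb ->] := spanT b; rewrite mulr_sumr.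
by apply: ideal_sum => // l _; rewrite mulrCA; exact: ideal_M.
Qed.

End Finite.
End Ideals.

(** * Finiteness of lifts of Frobenius on the affine cone *)

Section Span.
Variables (R : realType) (C : fieldType) (a : C -> R) (p : nat).
Hypotheses (aP : nonarch_abs a) (p_prime : prime p) (p_lt1 : a p%:R < 1).

(** For a row in the kernel, the equation at its entry of largest absolute value would make that
    entry strictly smaller than itself. *)
Lemma near_identity_unit m (M : 'M[C]_m) :
  (forall i j, a (M i j - (i == j)%:R) < 1) -> M \in unitmx.
Proof.
move=> hM; rewrite -row_free_unit -kermx_eq0; apply/negPn/negP => k0.
have u0 : nz_row (kermx M) != 0 by rewrite nz_row_eq0.
have /sub_kermxP uM : (nz_row (kermx M) <= kermx M)%MS by exact: nz_row_sub.
move: (nz_row _) u0 uM => u /rV0Pn[j0 uj0] uM.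
case: (arg_maxP (fun j => a (u 0 j)) (erefl : xpredT j0)) => j _ hj.
have hj' l : a (u 0 l) <= a (u 0 j) by exact: hj.
have uj : 0 < a (u 0 j) by apply: lt_le_trans (hj' j0); rewrite (abs_gt0 aP).
have e : u 0 j = - \sum_i u 0 i * (M i j - (i == j)%:R).
  have h : \sum_i u 0 i * M i j = 0.
    by have := congr1 (fun A : 'M_(_, _) => A 0 j) uM; rewrite !mxE.
  apply/eqP; rewrite -addr_eq0; apply/eqP; rewrite -[RHS]h.
  under [in LHS]eq_bigr => i _ do rewrite mulrBr.
  rewrite sumrB (bigD1 j) //= [X in _ - X](bigD1 j) //= eqxx mulr1.
  rewrite [X in _ - (_ + X)]big1 ?addr0 ?subrKC //.
  by move=> i /negPf ->; rewrite mulr0.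
have : a (u 0 j) < a (u 0 j).
  rewrite {1}e (absN aP); apply: (abs_sum_lt aP) => // i _; rewrite (absM aP).
  have [->|ui] := eqVneq (u 0 i) 0; first by rewrite (abs0 aP) mul0r.
  apply: lt_le_trans (hj' i); rewrite gtr_pMr //.
  by rewrite (abs_gt0 aP).
by rewrite ltxx.
Qed.

Variables (n k : nat) (T : n.-tuple {mpoly C[n]}).
Let Q := (p ^ k)%N.
Hypothesis T_frob : frob_like a T Q.
Hypothesis T_homog : forall i, tnth T i \is Q.-homog.

Let Q_gt0 : (0 < Q)%N. Proof. by rewrite expn_gt0 prime_gt0. Qed.
Let sM := gauss_small_ideal aP n p_prime p_lt1.

Let m := #|{ffun 'I_n -> 'I_Q}|.
Let e (i : 'I_m) : {mpoly C[n]} := 'X_[[multinom (enum_val i l : nat) | l < n]].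
Let spanned b := exists c : 'I_m -> {mpoly C[n]}, b = \sum_i (c i \mPo T) * e i.

(** Division of exponents by Q: the quotients become powers of the T_i, which reduce to Q-th powers,
    so [E mu] reduces to the monomial of exponent mu. *)
Let E (mu : 'X_{1..n}) : {mpoly C[n]} :=
  ('X_[[multinom mu i %/ Q | i < n]%N] \mPo T) * 'X_[[multinom mu i %% Q | i < n]%N].

Let spannedD b c : spanned b -> spanned c -> spanned (b + c).
Proof.
move=> [f ->] [g ->]; exists (fun i => f i + g i); rewrite -big_split.
by apply: eq_bigr => i _; rewrite comp_mpolyD mulrDl.
Qed.

Let spannedZ c b : spanned b -> spanned (c *: b).
Proof.
move=> [f ->]; exists (fun i => c *: f i); rewrite scaler_sumr.
by apply: eq_bigr => i _; rewrite comp_mpolyZ scalerAl.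
Qed.

Let spanned_sum (I : Type) (r : seq I) (F : I -> {mpoly C[n]}) :
  (forall i, spanned (F i)) -> spanned (\sum_(i <- r) F i).
Proof.
move=> h; elim/big_ind: _ => [|b c|i _]; [|exact: spannedD|exact: h].
by exists (fun=> 0); rewrite big1 // => i _; rewrite comp_mpoly0 mul0r.
Qed.

Let spannedE mu : spanned (E mu).
Proof.
pose f : {ffun 'I_n -> 'I_Q} := [ffun i => Ordinal (ltn_pmod (mu i) Q_gt0)].
exists (fun i => if i == enum_rank f then 'X_[[multinom mu i %/ Q | i < n]%N] else 0).
rewrite (bigD1 (enum_rank f)) //= eqxx big1 ?addr0 => [|i /negPf ->]; last first.
  by rewrite comp_mpoly0 mul0r.
rewrite /E /e; congr (_ * 'X_[_]); apply/mnmP => l.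
by rewrite !mnmE enum_rankK ffunE.
Qed.

Let E_near mu : coef_lt1 a (E mu - 'X_[mu]).
Proof.
have emu : mu = ([multinom mu i %/ Q | i < n]%N *+ Q + [multinom mu i %% Q | i < n]%N)%MM.
  by apply/mnmP => i; rewrite mnmDE mulmnE !mnmE -divn_eq.
rewrite {2}emu mpolyXD /E -mpolyXn -mulrBl mulrC; apply: (sid_IM sM).
  exact: coef_le_X.
rewrite comp_mpolyX mpolyXE_id -prodrXl; apply: (sid_congr_prod sM) => i.
  by apply: (sid_X sM); exact: (frob_like_le1 aP p_prime p_lt1 T_frob).
rewrite -exprM mulnC exprM; apply: (sid_congrX sM) => //.
exact: (frob_like_le1 aP p_prime p_lt1 T_frob).
Qed.

Let E_homog mu : E mu \is (mdeg mu).-homog.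
Proof.
have -> : mdeg mu = (Q * mdeg [multinom mu i %/ Q | i < n] + mdeg [multinom mu i %% Q | i < n])%N.
  rewrite !mdegE big_distrr -big_split /=; apply: eq_bigr => i _.
  by rewrite !mnmE mulnC -divn_eq.
by apply: dhomogM; [apply: dhomog_comp => //|]; rewrite dhomogX.
Qed.

(* Up to coefficients of absolute value < 1, the products of powers of the T_i
   with the monomials of exponents < Q are the monomials, so they are a basis. *)
Lemma frob_span b : exists c : 'I_m -> {mpoly C[n]}, b = \sum_i (c i \mPo T) * e i.
Proof.
rewrite -/(spanned b); set d := (msize b).
pose N := #|{: 'X_{1..n < d}}|.
pose ev (i : 'I_N) : 'X_{1..n} := val (enum_val i).
pose M : 'M[C]_N := \matrix_(i, j) (E (ev i))@_(ev j).
have uM : M \in unitmx.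
  apply: near_identity_unit => i j; rewrite mxE.
  have := E_near (ev i) (ev j); rewrite mcoeffB mcoeffX.
  by rewrite /ev (inj_eq val_inj) (inj_eq enum_val_inj).
(* [E mu] is homogeneous of the degree of mu, so monomials of degree < d suffice to express it and
   the matrix [M] is square. *)
have hE i : E (ev i) = \sum_j M i j *: 'X_[ev j].
  rewrite [LHS](@mpolywE _ _ d); last first.
    rewrite msizeE; apply/bigmax_leqP_seq => mu hmu _.
    by rewrite (dhomogP _ _ _ (E_homog _) mu hmu) /= bmdeg.
  rewrite (reindex (fun j : 'I_N => enum_val j)) /=; last first.
    exists enum_rank => j _; [exact: enum_valK|exact: enum_rankK].
  by apply: eq_bigr => j _; rewrite mxE.
have hX j : spanned 'X_[ev j].
  have -> : 'X_[ev j] = \sum_i (invmx M) j i *: E (ev i).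
    under eq_bigr => i _ do rewrite hE scaler_sumr.
    rewrite exchange_big /= (bigD1 j) //= -[LHS]addr0; congr (_ + _).
      under eq_bigr => i _ do rewrite scalerA.
      rewrite -scaler_suml; have := congr1 (fun A : 'M_(_, _) => A j j) (mulVmx uM).
      by rewrite !mxE => ->; rewrite eqxx scale1r.
    rewrite big1 // => l lj.
    under eq_bigr => i _ do rewrite scalerA.
    rewrite -scaler_suml; have := congr1 (fun A : 'M_(_, _) => A j l) (mulVmx uM).
    by rewrite !mxE => ->; rewrite eq_sym (negPf lj) scale0r.
  by apply: spanned_sum => i; apply: spannedZ; exact: spannedE.
rewrite (@mpolywE _ _ d b) //; apply: spanned_sum => mu; apply: spannedZ.
by have := hX (enum_rank mu); rewrite /ev enum_rankK.
Qed.

End Span.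

(** * The theorem *)

Section Coordinates.
Variables (C : fieldType) (N : nat).
Implicit Types (x y : proj_space C N) (v w : 'I_N.+1 -> C) (f : {mpoly C[N.+1]}).

Definition coords x v := hcoords x (\row_i v i).

Lemma row_funK v : (\row_i v i) ord0 = v.
Proof. by apply: funext => i; rewrite mxE. Qed.

Lemma coords_neq0 x v : coords x v -> exists i, v i != 0.
Proof. by move=> [v0 _]; have /rV0Pn[i] := v0; rewrite mxE; exists i. Qed.

Lemma coords_point v : (exists i, v i != 0) -> exists x, coords x v.
Proof.
move=> [i vi]; have v0 : \row_i v i != 0 by apply/rV0Pn; exists i; rewrite mxE.
by exists (\pi_(proj_space C N) (exist (fun u : 'rV[C]_N.+1 => u != 0) _ v0)), v0.
Qed.

Lemma coords_ex x : exists v, coords x v.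
Proof.
exists (val (repr x) ord0); rewrite /coords.
have -> : \row_i val (repr x) ord0 i = val (repr x).
  by apply/rowP => i; rewrite mxE.
exists (valP (repr x)); rewrite -[LHS]reprK; congr (\pi_(_) _).
exact: val_inj.
Qed.

Lemma coords_proportional x v w : coords x v -> coords x w ->
  exists2 c, c != 0 & w = scale_vec c v.
Proof.
move=> [v0 ->] [w0 /eqmodP/asboolP[c c0 /= e]]; exists c => //.
by rewrite -(row_funK w) e; apply: funext => i; rewrite !mxE.
Qed.

Lemma coords_scale x v c : c != 0 -> coords x v -> coords x (scale_vec c v).
Proof.
move=> c0 [v0 ->].
have w0 : \row_i scale_vec c v i != 0.
  have /rV0Pn[i] := v0; rewrite mxE => vi.
  by apply/rV0Pn; exists i; rewrite mxE mulf_neq0.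
exists w0; apply/eqmodP/asboolP; exists c => //=.
by apply/rowP => i; rewrite !mxE.
Qed.

Lemma coords_inj x y v : coords x v -> coords y v -> x = y.
Proof.
by move=> [v0 ->] [v0' ->]; congr (\pi_(_) _); exact: val_inj.
Qed.

Lemma vanishes_coords f x d v : f \is d.-homog -> coords x v ->
  vanishes_at f x <-> f.@[v] = 0.
Proof.
move=> fd xv; split=> [/(_ _ xv)|fv w xw]; first by rewrite row_funK.
have xw' : coords x (w ord0).
  suff e : \row_i w ord0 i = w by rewrite /coords e.
  by apply/rowP => i; rewrite mxE.
have [c _ ->] := coords_proportional xv xw'.
by rewrite (meval_scale _ _ fd) fv mulr0.
Qed.

End Coordinates.

Section FrobeniusLift.
Variables (R : realType) (C : fieldType) (a : C -> R) (p s N : nat).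
Hypotheses (aP : nonarch_abs a) (p_prime : prime p) (p_lt1 : a p%:R < 1).
Hypothesis s_gt0 : (0 < s)%N.
Hypothesis closedC : forall f : {poly C}, (1 < size f)%N -> exists r : C, root f r.
Hypothesis residue_alg : forall x, a x <= 1 ->
  exists2 k, (0 < k)%N & a (x ^+ (p ^ k) - x) < 1.
Hypothesis discrete_approx : forall (l : seq C) (e : R), 0 < e ->
  exists (K : C -> Prop) pi m, [/\ discrete_subfield a K pi, a pi ^+ m <= e &
    forall x, x \in l -> exists2 y, K y & a (x - y) <= a pi ^+ m].
Variable phi : N.+1.-tuple {mpoly C[N.+1]}.
Hypothesis phi_homog : forall i, tnth phi i \is (p ^ s).-homog.
Hypothesis phi_frob : frob_like a phi (p ^ s).
Variable F : proj_space C N -> proj_space C N.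
Hypothesis F_phi : forall x v, coords x v -> coords (F x) (eval_map phi v).
Implicit Types (x y : proj_space C N) (v w : 'I_N.+1 -> C).

Let phiT t := eval_map (iter_map phi t).
Let n := N.+1.

Lemma coords_iter t x v : coords x v -> coords (iter t F x) (phiT t v).
Proof.
move=> xv; rewrite /phiT eval_iter_map; elim: t => //= t IH; exact: F_phi.
Qed.

Lemma coords_normalized x : exists2 v, coords x v & normalized a v.
Proof.
have [v xv] := coords_ex x; have [i0 vi0] := coords_neq0 xv.
case: (arg_maxP (fun i => a (v i)) (erefl : xpredT i0)) => i _ hi.
have hi' l : a (v l) <= a (v i) by exact: hi.
have vi : 0 < a (v i) by apply: lt_le_trans (hi' i0); rewrite (abs_gt0 aP).
have vi0' : v i != 0 by rewrite -(abs_gt0 aP).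
exists (scale_vec (v i)^-1 v); first by apply: coords_scale; rewrite ?invr_eq0.
split=> [l|].
  by rewrite /scale_vec (absM aP) (absV aP) mulrC ler_pdivrMr // mul1r.
by exists i; rewrite /scale_vec mulVf // (abs1 aP).
Qed.

Lemma coords_periodic x : periodic_points F x ->
  exists2 v, coords x v & periodic_vec a phi v.
Proof.
move=> [t t0 Fx]; have [v xv nv] := coords_normalized x.
exists v => //; split=> //; exists t => //.
have := coords_iter t xv; rewrite Fx => xw.
by have [c _ e] := coords_proportional xv xw; exists c.
Qed.

Section Subvariety.
Variables (V : set (proj_space C N)).
Hypotheses (V_closed : zariski_closed V).
Hypothesis V_dense : zariski_dense_in (V `&` periodic_points F) V.

Lemma dense_closed (Z : set (proj_space C N)) : zariski_closed Z ->
  V `&` periodic_points F `<=` Z -> V `<=` Z.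
Proof. by move=> Zc SZ x /(V_dense.2 x); apply; split. Qed.

Lemma coefs_near (K : C -> Prop) pi m (g : {mpoly C[n]}) :
  discrete_subfield a K pi -> coef_le a g 1 ->
  (forall z : C, z \in [seq g@_u | u <- msupp g] ->
    exists2 t, K t & a (z - t) <= a pi ^+ m) ->
  coef_in (near_subfield a K pi m) g.
Proof.
move=> KP g1 hg u; split; first exact: g1.
have [gu|gu] := boolP (u \in msupp g); first by apply: hg; exact: map_f.
exists 0; first by rewrite -(subrr 1); apply: (dsf_B KP); exact: (dsf_1 KP).
by rewrite (memN_msupp_eq0 gu) subrr (abs0 aP) exprn_ge0 // (abs_ge0 aP).
Qed.

(* The reductions of the periodic points of V form a closed set: for each
   polynomial f vanishing on V, the condition |f| <= e on periodic points is a
   closed condition on reductions, and these closed sets stabilize. *)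
Lemma periodic_stable : exists2 L, (0 < L)%N &
  forall x, V x -> periodic_points F x -> V (iter L F x).
Proof.
have [S S_homog VS] := V_closed.
pose J (g : {mpoly C[n]}) := [/\ coef_le a g 1, exists e, g \is e.-homog &
  forall x v, V x -> coords x v -> periodic_vec a phi v -> a g.@[v] < 1].
(* The finite list [l] determines L before any equation of V or any precision is chosen, yet it
   controls all of [J], including the polynomials that [approx_closed] produces later. *)
have [l lJ hl] : exists2 l : seq {mpoly C[n]}, (forall g, g \in l -> J g) &
    forall v, (forall i, a (v i) <= 1) -> (forall g, g \in l -> a g.@[v] < 1) ->
      forall g, J g -> a g.@[v] < 1.
  by apply: finite_cut => // g [].
have [g|L L0 hL] := residue_fixed_mpolys aP p_prime p_lt1 residue_alg (s := l).
  by move=> /lJ[].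
exists L => // x Vx px; have [v xv pv] := coords_periodic px.
have pw : periodic_vec a phi (phiT L v).
  exact: (periodic_phiT aP p_prime p_lt1 phi_homog phi_frob L pv).
have xw := coords_iter L xv; have [[v1 _] _] := pv; have [[w1 _] _] := pw.
have hJ g : J g -> a g.@[phiT L v] < 1.
  apply: hl => // h hh; have [h1 _ hV] := lJ _ hh.
  rewrite (fixed_lt1 aP p_prime p_lt1 (iter_phi_frob aP p_prime p_lt1 phi_frob L)) //.
    exact: (hV x).
  by move=> m; rewrite mulnC; exact: hL.
rewrite VS /= => f Sf; have [d fd] := S_homog _ Sf.
apply/(vanishes_coords fd xw).
have [c c0 h1] := coef_le_scale aP f; set h := c *: f in h1.
have hd : h \is d.-homog by exact: dhomogZ.
suff : h.@[phiT L v] = 0.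
  by move=> /eqP; rewrite mevalZ mulf_eq0 (negPf c0) => /eqP.
apply/eqP; rewrite -(abs_eq0 aP) eq_le (abs_ge0 aP) andbT leNgt.
apply/negP => h0; set e := a h.@[phiT L v] / 2.
have e0 : 0 < e by rewrite divr_gt0.
have phi1 i : coef_le a (tnth phi i) 1 by exact: (frob_like_le1 aP p_prime p_lt1 phi_frob).
(* One field [K] must serve for the coefficients of h and of [phi] together, at the precision e,
   half of the value to be excluded. *)
have [K [pi [m [KP me near]]]] := discrete_approx
  (flatten [seq [seq g@_u | u <- msupp g] | g <- h :: phi]) e0.
have near_g g : g \in h :: phi -> coef_le a g 1 -> coef_in (near_subfield a K pi m) g.
  move=> gp g1; apply: coefs_near => // y hy; apply: near.
  apply/flattenP; exists [seq g@_u | u <- msupp g] => //.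
  exact: (map_f (fun g : {mpoly C[n]} => [seq g@_u | u <- msupp g]) gp).
have [||J' [J'1 J'2]] := @approx_closed R C a p s n aP p_prime p_lt1 s_gt0
    residue_alg phi phi_homog phi_frob K pi m KP _ m h d (leqnn m) _ hd.
- by move=> i; apply: near_g => //; rewrite inE mem_tnth orbT.
- by apply: near_g => //; rewrite mem_head.
have : a h.@[phiT L v] <= a pi ^+ m.
  (* h vanishes on V, so its periodic vectors satisfy the conditions [J']; hence [J'] is contained
     in [J], which controls the image under F^L. *)
  apply/(J'2 _ pw) => g J'g; apply: hJ; have [g1 ge] := J'1 g J'g; split=> //.
  move=> y u Vy yu pu; apply: (J'2 u pu).1 J'g.
  have fy : f.@[u] = 0.
    by apply/(vanishes_coords fd yu); move: Vy; rewrite VS => /(_ f Sf).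
  by rewrite mevalZ fy mulr0 (abs0 aP) exprn_ge0 // (abs_ge0 aP).
move=> /le_trans/(_ me); rewrite /e leNgt ltr_pdivrMr // ltr_pMr //.
by rewrite ltr1n.
Qed.

Lemma preimage_closed L : zariski_closed [set x | V (iter L F x)].
Proof.
have [S S_homog VS] := V_closed.
exists [set g | exists2 f, S f & g = f \mPo iter_map phi L].
  move=> _ [f /S_homog[d fd] ->]; exists (p ^ (s * L) * d)%N.
  by apply: dhomog_comp => // i; exact: iter_phi_homog.
have hom i : tnth (iter_map phi L) i \is (p ^ (s * L)).-homog by exact: iter_phi_homog.
have eqv f d x v : f \is d.-homog -> coords x v ->
    vanishes_at (f \mPo iter_map phi L) x <-> vanishes_at f (iter L F x).
  move=> fd xv; rewrite (vanishes_coords (dhomog_comp hom fd) xv).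
  by rewrite (vanishes_coords fd (coords_iter L xv)) meval_comp.
apply/seteqP; split=> x /=.
  rewrite VS /= => hx _ [f Sf ->]; have [d fd] := S_homog _ Sf.
  have [v xv] := coords_ex x; apply/(eqv f d x v fd xv); exact: hx.
move=> hx; rewrite VS /= => f Sf; have [d fd] := S_homog _ Sf.
have [v xv] := coords_ex x; apply/(eqv f d x v fd xv); apply: hx.
by exists f.
Qed.

(** As a function of c, D(c v) is a polynomial whose coefficients are the values at v of the
    homogeneous parts of D, and it vanishes for all nonzero c. *)
Lemma homog_parts_vanish (D : {mpoly C[n]}) v :
  (forall c, c != 0 -> D.@[scale_vec c v] = 0) -> forall d, (pihomog mdeg d D).@[v] = 0.
Proof.
move=> hD; pose P : {poly C} := \poly_(d < msize D) (pihomog mdeg d D).@[v].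
have eP c : P.[c] = D.@[scale_vec c v].
  rewrite [in RHS](pihomog_partitionE (leqnn (msize D))) raddf_sum /= horner_poly; apply: eq_bigr => d _.
  by rewrite (meval_scale _ _ (pihomogP mdeg d D)) mulrC.
have P0 : P = 0.
  apply: contrapT => /eqP P0.
  (* A root c of X P + 1 is nonzero, so P(c) = 0 and the equation becomes 1 = 0; this replaces
     counting infinitely many roots of P. *)
  have sz : size ('X * P + 1) = (size P).+1.
    by rewrite size_polyDl ?size_polyC ?oner_eq0 mulrC size_mulX // ltnS size_poly_gt0.
  have [|c /rootP] := closedC (f := 'X * P + 1); first by rewrite sz ltnS size_poly_gt0.
  rewrite hornerD hornerM hornerX hornerC => /eqP.
  have [->|c0] := eqVneq c 0; first by rewrite mul0r add0r oner_eq0.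
  by rewrite eP hD // mulr0 add0r oner_eq0.
move=> d; have [dD|dD] := ltnP d (msize D).
  by have := congr1 (fun Q : {poly C} => Q`_d) P0; rewrite coef_poly dD coef0.
have -> : pihomog mdeg d D = 0.
  rewrite pihomogE big_seq_cond big1 // => m /andP[mD /eqP md].
  by have := msize_mdeg_lt mD; rewrite md ltnNge dD.
by rewrite meval0.
Qed.

Lemma pow_surjective Q (c : C) : (0 < Q)%N -> exists b, b ^+ Q = c.
Proof.
move=> Q0; have [|b /rootP] := closedC (f := 'X^Q - c%:P).
  by rewrite size_XnsubC.
by rewrite !hornerE => /eqP; rewrite subr_eq0 => /eqP; exists b.
Qed.

Lemma iter_image_eq : exists2 L, (1 <= L)%N & iter L F @` V = V.
Proof.
have [L L0 hL] := periodic_stable; exists L => //.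
have VL : V `<=` [set x | V (iter L F x)].
  apply: dense_closed; first exact: preimage_closed.
  by move=> x [Vx px]; exact: hL.
apply/seteqP; split; first by move=> _ [x /VL Vx <-].
set Q := (p ^ (s * L))%N; have Q0 : (0 < Q)%N by rewrite expn_gt0 prime_gt0.
pose T := iter_map phi L.
have T_homog i : tnth T i \is Q.-homog by exact: iter_phi_homog.
have T_frob : frob_like a T Q by exact: (iter_phi_frob aP p_prime p_lt1 phi_frob).
move=> y Vy; have [w yw] := coords_ex y.
pose I (b : {mpoly C[n]}) := forall x v, V x -> coords x v -> b.@[v] = 0.
have HI : ideal_like I.
  split=> [x v _ _|f g hf hg x v Vx xv|f g hg x v Vx xv]; first by rewrite meval0.
    by rewrite mevalD (hf x) ?(hg x) ?addr0.
  by rewrite mevalM (hg x) ?mulr0.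
have [S S_homog VS] := V_closed.
have [[c [cI cw]]|[D [DI Dw]]] := fiber_point_or_cut closedC
    (frob_span aP p_prime p_lt1 T_frob T_homog) w HI.
  have Tc : eval_map T c = w by apply: funext => i; exact: cw.
  (* The vector c is nonzero: [T] is homogeneous of positive degree and sends 0 to 0, whereas w is
     nonzero. *)
  have [x xc] : exists x, coords x c.
    apply: coords_point; apply: contrapT => c0.
    have [i] := coords_neq0 yw; rewrite -Tc.
    have -> : c = scale_vec 0 c.
      apply: funext => i'; rewrite /scale_vec mul0r; apply: contrapT => /eqP ci.
      by apply: c0; exists i'.
    rewrite (eval_map_scale _ _ T_homog) /scale_vec.
    by rewrite expr0n eqn0Ngt Q0 mul0r eqxx.
  exists x; last first.
    by apply: (coords_inj (coords_iter L xc)); rewrite /phiT -/T Tc.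
  rewrite VS /= => f Sf; have [d fd] := S_homog _ Sf; apply/(vanishes_coords fd xc).
  apply: cI => x' v; rewrite VS => /(_ f Sf) fx x'v.
  exact/(vanishes_coords fd x'v).
(* The point x is the image under F^L of its iterate of order (r - 1) L, which is in V; there D o
   F^L vanishes. *)
have DS x v : V x -> periodic_points F x -> coords x v -> D.@[v] = 0.
  move=> Vx [r r0 Fx] xv.
  have Vi t : V (iter (t * L) F x).
    by elim: t => [|t IH] //; rewrite mulSn iterD; exact: VL.
  have [v' x'v'] := coords_ex (iter (r.-1 * L) F x).
  have := coords_iter L x'v'; rewrite -iterD -mulSn prednK //.
  have -> : iter (r * L) F x = x.
    by rewrite mulnC; elim: (L) => [|t IH] //; rewrite mulSn iterD IH.
  (* D need not be homogeneous, so the given coordinates of x must be hit exactly: the scalar is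
     absorbed by scaling the preimage by a Q-th root. *)
  move=> /coords_proportional/(_ xv)[c c0 ->]; have [b bc] := pow_surjective c Q0.
  rewrite -bc /phiT -/T -(eval_map_scale _ _ T_homog) -meval_comp.
  rewrite -[_ \mPo _]mulr1; apply: (DI 1 _ _ (Vi r.-1)); apply: coords_scale => //.
  by apply: contraNneq c0 => b0; rewrite -bc b0 expr0n eqn0Ngt Q0.
(* Zariski density applies to homogeneous equations only, so D is treated one homogeneous part at a
   time; their values at w add up to D(w). *)
have Dd d : (pihomog mdeg d D).@[w] = 0.
  have hd := pihomogP mdeg d D.
  apply/(vanishes_coords hd yw).
  apply: (dense_closed (Z := [set x | forall f, f = pihomog mdeg d D -> vanishes_at f x])) => //.
    by exists [set f | f = pihomog mdeg d D] => // _ ->; exists d.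
  move=> x [Vx px] _ ->; have [v xv] := coords_ex x.
  apply/(vanishes_coords hd xv); apply: homog_parts_vanish => c c0.
  by apply: (DS x) => //; exact: coords_scale.
have := oner_neq0 C; rewrite -Dw (pihomog_partitionE (leqnn (msize D))) raddf_sum /= big1 ?eqxx //.
Qed.

End Subvariety.
End FrobeniusLift.

Theorem theorem1p1 (R : realType) (p : nat) (p_prime : prime p)
    (C : fieldType) (a : C -> R) (C_is_Cp : is_Cp p a)
    (N : nat) (F : proj_space C N -> proj_space C N)
    (F_lift : lift_of_Frobenius p a F)
    (V : set (proj_space C N)) (V_irr : irreducible_subvariety V)
    (V_dense : zariski_dense_in (V `&` periodic_points F) V) :
  exists2 l : nat, (1 <= l)%N & iter l F @` V = V.
Proof.
have [Qp [aQp [i [Qpbar [aQpbar [j [k [Qp_compl j_alg bP j_isom C_compl]]]]]]]] := C_is_Cp.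
have [V_closed _ _] := V_irr.
have [s [p' [P [s0 p'1 P_homog P1 hF]]]] := F_lift.
have aP := completion_abs C_compl.
pose phi : N.+1.-tuple {mpoly C[N.+1]} := [tuple 'X_i ^+ (p ^ s) + p' *: P i | i < N.+1].
have phiE l : tnth phi l = 'X_l ^+ (p ^ s) + p' *: P l by rewrite tnth_mktuple.
apply: (@iter_image_eq R C a p s N aP p_prime _ s0 _ _ _ phi) => //.
- exact: (abs_nat_p_lt1 p_prime Qp_compl j_isom C_compl).
- by move=> f; exact: completion_root C_compl.
- exact: (residue_alg_Cp p_prime Qp_compl j_alg bP j_isom C_compl).
- exact: (Cp_discrete_approx p_prime Qp_compl j_alg bP j_isom C_compl).
- move=> l; rewrite phiE; apply: dhomogD; last exact: dhomogZ.
  rewrite -[X in X.-homog]mul1n; apply: dhomogMn.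
  by rewrite dhomogX /= mdeg1.
- move=> l; rewrite phiE addrC addKr => m; rewrite mcoeffZ (absM aP).
  by apply: le_lt_trans p'1; apply: ler_piMr => //; exact: (abs_ge0 aP).
move=> x v xv; have := hF x _ xv; rewrite /coords.
suff -> : lift_coords (p ^ s) p' P (\row_i0 v i0) = \row_i0 eval_map phi v i0 by [].
apply/rowP => l; rewrite !mxE /eval_map phiE row_funK.
by rewrite mevalD mevalZ rmorphXn /= mevalXU.
Qed.
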